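(* Consider the fully discrete quasi-Lagrange moving mesh DG scheme: for all elements and all test functions, $$\int_{K^{n,(1)}}U_h^{n,(1)}\phi^{n,(1)}d\bm x=\int_{K^n}U_h^n\phi^n d\bm x+\Delta t_n\,\mathcal L(U_h^n,h_h^n,\phi^n,B_h^n)|_{K^n},$$ $$\int_{K^{n,(2)}}U_h^{n,(2)}\phi^{n,(2)}d\bm x=\tfrac34\int_{K^n}U_h^n\phi^n d\bm x+\tfrac14\int_{K^{n,(1)}}U_h^{n,(1)}\phi^{n,(1)}d\bm x+\tfrac14\Delta t_n\,\mathcal L(U_h^{n,(1)},h_h^{n,(1)},\phi^{n,(1)},B_h^{n,(1)})|_{K^{n,(1)}},$$ $$\int_{K^{n+1}}U_h^{n+1}\phi^{n+1}d\bm x=\tfrac13\int_{K^n}U_h^n\phi^n d\bm x+\tfrac23\int_{K^{n,(2)}}U_h^{n,(2)}\phi^{n,(2)}d\bm x+\tfrac23\Delta t_n\,\mathcal L(U_h^{n,(2)},h_h^{n,(2)},\phi^{n,(2)},B_h^{n,(2)})|_{K^{n,(2)}},$$ where $$\mathcal L(U_h,h_h,\phi,B_h)|_K=-\sum_{e_K\subset\partial K}\int_{e_K}\phi\,\hat{\mathbf H}^*|_{e_K}ds+\int_K\mathbf H(U_h,h_h)\cdot\nabla\phi\,d\bm x+\int_K S(\eta_h,B_h)\phi\,d\bm x .$$ Suppose that the areas of the mesh elements are updated according to $$|K^{n,(1)}|=|K^n|+\Delta t_n|K^n|\,\nabla\cdot\dot{\bm X}^n_{K^n},$$ $$|K^{n,(2)}|=\tfrac34|K^n|+\tfrac14\big(|K^{n,(1)}|+\Delta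 t_n|K^{n,(1)}|\,\nabla\cdot\dot{\bm X}^{n,(1)}_{K^{n,(1)}}\big),$$ $$|K^{n+1}|=\tfrac13|K^n|+\tfrac23\big(|K^{n,(2)}|+\Delta t_n|K^{n,(2)}|\,\nabla\cdot\dot{\bm X}^{n,(2)}_{K^{n,(2)}}\big),$$ and that all integrals in $\mathcal L$ are computed exactly. Then the scheme preserves the lake-at-rest steady-state solutions: for any constant $C$, $\eta_h^n\equiv C$, $m_h^n\equiv0$ and $w_h^n\equiv0$ imply $\eta_h^{n+1}\equiv C$, $m_h^{n+1}\equiv0$ and $w_h^{n+1}\equiv0$.
   Context: Setting: two-dimensional shallow water equations in the variables $U=(\eta,m,w)^T$, where $h$ is the water depth, $B=B(x,y)$ the bottom topography, $\eta=h+B$, $(m,w)=(hu,hv)$, $g>0$ the gravity constant: $U_t+\nabla\cdot\mathbf F(U,h)=S(\eta,B)$ with $$S(\eta,B)=(0,-g\eta B_x,-g\eta B_y)^T,\qquad \mathbf F(U,h)=\begin{bmatrix} m & w\\ \frac{m^2}{h}+\frac12 g(2h\eta-\eta^2) & \frac{mw}{h}\\ \frac{mw}{h} & \frac{w^2}{h}+\frac12 g(2h\eta-\eta^2)\end{bmatrix}.$$ Moving mesh: $\Omega\subset\mathbb R^2$ is a polygonal domain. For $t\in[t_n,t_{n+1}]$, $\Delta t_n=t_{n+1}-t_n$, $\mathcal T_h(t)$ is a triangulation of $\Omega$ with fixed connectivity and vertices $\bm x_i(t)=\frac{t_{n+1}-t}{\Delta t_n}\bm x_i^n+\frac{t-t_n}{\Delta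 t_n}\bm x_i^{n+1}$, $i=1,\dots,N_v$, where $\bm x_i^n,\bm x_i^{n+1}$ are the vertices of given triangulations at $t_n,t_{n+1}$. The nodal velocities are $\dot{\bm x}_i=(\bm x_i^{n+1}-\bm x_i^n)/\Delta t_n$, and $\dot{\bm X}=(\dot X,\dot Y)$ is the continuous piecewise linear function $\dot{\bm X}(\bm x,t)=\sum_i\dot{\bm x}_i\phi_i(\bm x,t)$, with $\phi_i$ the linear nodal basis function of vertex $i$. $\mathcal V_h^k(t)=\{q\in L^2(\Omega): q|_K\in P^k(K)\ \forall K\in\mathcal T_h(t)\}$, $k\ge1$. Stages: quantities with superscript $n$, $n,(1)$, $n,(2)$, $n+1$ live on the mesh $\mathcal T_h(t)$ at $t=t_n$, $t_n+\Delta t_n$, $t_n+\frac12\Delta t_n$, $t_n+\Delta t_n$, respectively; $K^n,K^{n,(1)},K^{n,(2)},K^{n+1}$ are corresponding elements. The components of $U_h$ and $B_h$ at each stage lie in the corresponding $\mathcal V_h^k$; $B_h$ at each stage is an approximation of $B$ (e.g. the $L^2$-projection; no particular choice is required), and $h_h=\eta_h-B_h$ at each stage. Test functions at the different stages correspond to one another: $\phi^{\ast}(\bm x)=\hat\phi(F_{K^{\ast}}^{-1}(\bm x))$ for an arbitrary polynomial $\hat\phi$ of degree at most $k$ on the reference element $\hat K$, $F_{K^\ast}:\hat K\to K^\ast$ the affine map. Areas: the integrals $\int_{K^\ast}q\,d\bm x$ on the left-hand sides and the corresponding integrals $\int_{K^\ast}U_h\phi\,d\bm x$ on the right-hand sides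 are computed as $\frac{|K^\ast|}{|\hat K|}\int_{\hat K}q\circ F_{K^\ast}\,d\bm\xi$, where $|K^n|$ is the actual area of $K^n$ and $|K^{n,(1)}|,|K^{n,(2)}|,|K^{n+1}|$ are the (positive) values given by the area update in the claim (which at intermediate stages need not equal the areas computed from vertex coordinates). $\nabla\cdot\dot{\bm X}_{K^\ast}$ is the constant divergence of $\dot{\bm X}$ on $K^\ast$, in whose computation the element area is taken to be the same value $|K^\ast|$; i.e. $|K^\ast|\,\nabla\cdot\dot{\bm X}_{K^\ast}=\int_{\partial K^\ast}\dot{\bm X}\cdot\bm n\,ds$. Define $\mathbf H(U,h)=\mathbf F(U,h)-U\dot{\bm X}$ (a $3\times 2$ matrix, $U$ a column and $\dot{\bm X}$ a row; $\mathbf H\cdot\bm n$ and $\mathbf H\cdot\nabla\phi$ are matrix-vector products). Derivatives of $B_h$ in $S(\eta_h,B_h)$ are taken elementwise. Traces: for a piecewise polynomial $q_h$, $q_{h,K}^{int}$ and $q_{h,K}^{ext}$ are its values on $\partial K$ from the interior and the exterior of $K$; $h_{h,K}^{int}=\eta_{h,K}^{int}-B_{h,K}^{int}$, $h_{h,K}^{ext}=\eta_{h,K}^{ext}-B_{h,K}^{ext}$. $\bm n_K^e=(n_x,n_y)^T$ is the outward unit normal to $K$ on the edge $e_K\subset\partial K$. On edges lying on $\partial\Omega$ the exterior values come from boundary conditions compatible with the lake at rest, i.e. $U_{h,K}^{ext}=(C,0,0)^T$ whenever $U_h\equiv(C,0,0)^T$. Lax–Friedrichs flux: $$\hat{\mathbf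 H}(U^1,h^1;U^2,h^2;\bm n)=\tfrac12\Big(\big(\mathbf H(U^1,h^1)+\mathbf H(U^2,h^2)\big)\cdot\bm n-\alpha_h(U^2-U^1)\Big),$$ where $\alpha_h=\max_{K,e_K,m}\max\big(|\lambda^m(U_{h,K}^{int},h_{h,K}^{int},\dot{\bm X}|_{e_K})|,|\lambda^m(U_{h,K}^{ext},h_{h,K}^{ext},\dot{\bm X}|_{e_K})|\big)$ and, with $c=\sqrt{gh}$, $u=m/h$, $v=w/h$, the numbers $\lambda^m(U,h,\dot{\bm X})$, $m=1,2,3$, are $(u-\dot X)n_x+(v-\dot Y)n_y-c$, $(u-\dot X)n_x+(v-\dot Y)n_y$ and $(u-\dot X)n_x+(v-\dot Y)n_y+c$. Hydrostatic reconstruction on $e_K$: $$h_{h,K}^{*,int}=\max\big(0,\eta_{h,K}^{int}-\max(B_{h,K}^{int},B_{h,K}^{ext})\big),\quad h_{h,K}^{*,ext}=\max\big(0,\eta_{h,K}^{ext}-\max(B_{h,K}^{int},B_{h,K}^{ext})\big),$$ and $U^{*}=(\eta^*,m^*,w^* )^T$ with (for both int and ext) $\eta_{h,K}^{*}=\eta_{h,K}$, $m_{h,K}^{*}=\frac{h_{h,K}^{*}}{h_{h,K}}m_{h,K}$, $w_{h,K}^{*}=\frac{h_{h,K}^{*}}{h_{h,K}}w_{h,K}$. Modified flux: $$\hat{\mathbf H}^*|_{e_K}=\hat{\mathbf H}\big(U_{h,K}^{*,int},h_{h,K}^{*,int};U_{h,K}^{*,ext},h_{h,K}^{*,ext};\bm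 n_K^e\big)+\Delta^*_{e_K}\cdot\bm n_K^e,$$ $$\Delta^*_{e_K}=\begin{bmatrix}0&0\\ g\,\eta_{h,K}^{int}\big(h_{h,K}^{int}-h_{h,K}^{*,int}\big)&0\\ 0& g\,\eta_{h,K}^{int}\big(h_{h,K}^{int}-h_{h,K}^{*,int}\big)\end{bmatrix}.$$ Conventions: the water depth is nonnegative at all stages, and all quotients with numerator built from $m=w=0$ (such as $m/h$, $m^2/h$, $mw/h$, $w^2/h$, $\frac{h^*}{h}m$) are taken to be $0$, also when $h=0$. *)

(* Defs.v *)
From HB Require Import structures.
From mathcomp Require Import all_boot all_order all_algebra.
From mathcomp Require Import all_classical all_reals all_analysis.

Set Implicit Arguments.
Unset Strict Implicit.
Unset Printing Implicit Defensive.
Import Order.TTheory GRing.Theory Num.Theory.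
Import numFieldNormedType.Exports.
Local Open Scope classical_set_scope.
Local Open Scope ring_scope.

Section PlaneGeometry.
Variable R : realType.
Implicit Types (p q : R * R) (T : 'I_3 -> R * R) (e : 'I_3).

Definition cross p q : R := p.1 * q.2 - p.2 * q.1.

(* The norm of the library on R * R is the max norm. *)
Definition enorm p : R := Num.sqrt (p.1 ^+ 2 + p.2 ^+ 2).

(* Convex hull of the points x i, i \in V. *)
Definition hull (I : finType) (x : I -> R * R) (V : {set I}) : set (R * R) :=
  [set p | exists c : I -> R,
     [/\ forall i, 0 <= c i, forall i, i \notin V -> c i = 0,
         \sum_i c i = 1,
         p.1 = \sum_i c i * (x i).1 & p.2 = \sum_i c i * (x i).2]].

Definition triangle T : set (R * R) := hull T [set: 'I_3]%SET.

(* Twice the signed area. *)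
Definition det3 T : R := cross (T 1 - T 0) (T 2%:R - T 0).

Definition nondegenerate_triangle T : Prop := det3 T != 0.

Definition area (D : set (R * R)) : R :=
  fine ((lebesgue_measure \x lebesgue_measure)%E D).

(* Barycentric coordinate of p relative to the vertex T a. *)
Definition bary T (a : 'I_3) p : R :=
  cross (T (ordS (ordS a)) - T (ordS a)) (p - T (ordS a)) / det3 T.

(* The affine map sending the vertices of S to those of T; its inverse is
   affmap T S. *)
Definition affmap (S T : 'I_3 -> R * R) p : R * R :=
  (\sum_a bary S a p * (T a).1, \sum_a bary S a p * (T a).2).

(* Edge e is the one opposite to the vertex T e. *)
Definition edge_start T e : R * R := T (ordS e).
Definition edge_end T e : R * R := T (ordS (ordS e)).
Definition edge_point T e (s : R) : R * R :=
  ((1 - s) * (edge_start T e).1 + s * (edge_end T e).1,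
   (1 - s) * (edge_start T e).2 + s * (edge_end T e).2).
Definition edge_length T e : R := enorm (edge_end T e - edge_start T e).

(* Outward unit normal.  Rotating the edge clockwise gives the outward
   direction for a counterclockwise triangle; the sign of det3 T corrects
   the other orientation. *)
Definition outer_normal T e : R * R :=
  let d := edge_end T e - edge_start T e in
  (Num.sg (det3 T) * d.2 / edge_length T e,
   - (Num.sg (det3 T) * d.1 / edge_length T e)).

Definition int2 (D : set (R * R)) (f : R * R -> R) : R :=
  \int[(lebesgue_measure \x lebesgue_measure)%E]_(p in D) f p.

(* Line integral with respect to arc length. *)
Definition int_edge T e (f : R * R -> R) : R :=
  edge_length T e *
  \int[lebesgue_measure]_(s in `[0%R, 1%R]) f (edge_point T e s).

Definition dx (f : R * R -> R) p : R := derive1 (fun s => f (s, p.2)) p.1.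
Definition dy (f : R * R -> R) p : R := derive1 (fun s => f (p.1, s)) p.2.

(* Polynomial functions of two variables of total degree at most k. *)
Definition poly_deg (k : nat) (f : R * R -> R) : Prop :=
  exists c : nat -> nat -> R, forall p,
    f p = \sum_(i < k.+1) \sum_(j < (k - i).+1) c i j * p.1 ^+ i * p.2 ^+ j.

Definition segment p q : set (R * R) :=
  [set r | exists2 s : R, 0 <= s <= 1 &
     r = ((1 - s) * p.1 + s * q.1, (1 - s) * p.2 + s * q.2)].

(* Requiring Omega = (closure Omega)^o excludes slits, so that the edges of a
   triangulation lying on the boundary are those with a single neighbouring
   element. *)
Definition polygonal_domain (Omega : set (R * R)) : Prop :=
  [/\ open Omega, connected Omega, Omega !=set0, bounded_set Omega &
      Omega = (closure Omega)° /\
      exists s : seq ((R * R) * (R * R)),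
        closure Omega `\` Omega = \bigcup_(pq in [set` s]) segment pq.1 pq.2].

End PlaneGeometry.

Section Mesh.
Variables (R : realType) (Nv Ne : nat) (conn : 'I_Ne -> 'I_3 -> 'I_Nv).
Implicit Types (x xd : 'I_Nv -> R * R) (K : 'I_Ne) (e : 'I_3).

Definition verts K : {set 'I_Nv} := [set conn K a | a : 'I_3].

Definition elt x K : 'I_3 -> R * R := fun a => x (conn K a).

Definition triangulation (Omega : set (R * R)) x : Prop :=
  [/\ forall K, nondegenerate_triangle (elt x K),
      closure Omega = \bigcup_K triangle (elt x K),
      forall K K', K != K' -> verts K != verts K',
      forall K K', K != K' ->
        triangle (elt x K) `&` triangle (elt x K') =
        hull x (verts K :&: verts K')%SET &
      forall i, exists K, i \in verts K].

Definition edge_verts K e : {set 'I_Nv} :=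
  [set conn K (ordS e); conn K (ordS (ordS e))].

(* The element on the other side of edge e of K; None on the boundary. *)
Definition neighbor K e : option 'I_Ne :=
  [pick K' | (K' != K) && (edge_verts K e \subset verts K')].

(* Restriction to K of the linear nodal basis function of vertex i. *)
Definition nodal x (i : 'I_Nv) K (p : R * R) : R :=
  \sum_(a | conn K a == i) bary (elt x K) a p.

(* The mesh velocity on K; xd holds the nodal velocities. *)
Definition mesh_vel x xd K (p : R * R) : R * R :=
  (\sum_i (xd i).1 * nodal x i K p, \sum_i (xd i).2 * nodal x i K p).

Definition vertex_at (tn tn1 : R) (xn xn1 : 'I_Nv -> R * R) (t : R) :
    'I_Nv -> R * R :=
  fun i => let a := (tn1 - t) / (tn1 - tn) in let b := (t - tn) / (tn1 - tn) in
    (a * (xn i).1 + b * (xn1 i).1, a * (xn i).2 + b * (xn1 i).2).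

Definition nodal_vel (tn tn1 : R) (xn xn1 : 'I_Nv -> R * R) :
    'I_Nv -> R * R :=
  fun i => (((xn1 i).1 - (xn i).1) / (tn1 - tn),
            ((xn1 i).2 - (xn i).2) / (tn1 - tn)).

End Mesh.

Section ShallowWater.
Variables (R : realType) (g : R).
Implicit Types (U : 'cV[R]_3) (h : R) (X n : R * R).

Definition vec3 (a b c : R) : 'cV[R]_3 := \col_i nth 0 [:: a; b; c] i.
Definition col2 (p : R * R) : 'cV[R]_2 := \col_i nth 0 [:: p.1; p.2] i.
Definition mat32 (rows : seq (R * R)) : 'M[R]_(3, 2) :=
  \matrix_(i, j) col2 (nth 0 rows i) j 0.

Definition eta_of U : R := U 0 0.
Definition m_of U : R := U 1 0.
Definition w_of U : R := U 2%:R 0.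

(* Here and below x / 0 = 0 in the library, as required by the convention on
   the quotients when the discharge vanishes. *)
Definition fluxF U h : 'M[R]_(3, 2) :=
  let: (eta, m, w) := (eta_of U, m_of U, w_of U) in
  let P := 2%:R^-1 * g * (2%:R * h * eta - eta ^+ 2) in
  mat32 [:: (m, w);
            (m ^+ 2 / h + P, m * w / h);
            (m * w / h, w ^+ 2 / h + P)].

Definition fluxH U h X : 'M[R]_(3, 2) := fluxF U h - U *m (col2 X)^T.

Definition wave_speed (i : 'I_3) U h X n : R :=
  let vn := (m_of U / h - X.1) * n.1 + (w_of U / h - X.2) * n.2 in
  let c := Num.sqrt (g * h) in
  nth 0 [:: vn - c; vn; vn + c] i.

Definition lax_friedrichs (alpha : R) U1 h1 U2 h2 X n : 'cV[R]_3 :=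
  2%:R^-1 *: ((fluxH U1 h1 X + fluxH U2 h2 X) *m col2 n - alpha *: (U2 - U1)).

Definition source (eta B : R * R -> R) (p : R * R) : 'cV[R]_3 :=
  vec3 0 (- g * eta p * dx B p) (- g * eta p * dy B p).

(* The reconstructed state with depth hs in place of h. *)
Definition recon U h hs : 'cV[R]_3 :=
  vec3 (eta_of U) (hs / h * m_of U) (hs / h * w_of U).

End ShallowWater.

(* The numerical solution at one stage.  A piecewise polynomial is a family,
   indexed by the elements, of polynomial functions on the plane: traces and
   elementwise derivatives are those of the polynomial of the element.
   vol K is the value |K| used for the element area; Ubd K e and Bbd K e are
   the exterior values on the boundary edges. *)
Record stage (R : realType) (Ne : nat) := Stage {
  sol : 'I_Ne -> R * R -> 'cV[R]_3;
  bot : 'I_Ne -> R * R -> R;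
  vol : 'I_Ne -> R;
  Ubd : 'I_Ne -> 'I_3 -> R * R -> 'cV[R]_3;
  Bbd : 'I_Ne -> 'I_3 -> R * R -> R
}.

Section Scheme.
Variables (R : realType) (g : R) (Nv Ne : nat).
Variables (conn : 'I_Ne -> 'I_3 -> 'I_Nv) (Khat : 'I_3 -> R * R).
Implicit Types (x xd : 'I_Nv -> R * R) (s : stage R Ne).
Implicit Types (K : 'I_Ne) (e : 'I_3) (p : R * R) (phi phihat : R * R -> R).

Definition depth s K p : R := eta_of (sol s K p) - bot s K p.

Definition Uext s K e p : 'cV[R]_3 :=
  if neighbor conn K e is Some K' then sol s K' p else Ubd s K e p.
Definition Bext s K e p : R :=
  if neighbor conn K e is Some K' then bot s K' p else Bbd s K e p.
Definition hext s K e p : R := eta_of (Uext s K e p) - Bext s K e p.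

(* eta = C and m = w = 0 on every element. *)
Definition lake_at_rest x s (C : R) : Prop :=
  forall K p, triangle (elt conn x K) p ->
    [/\ eta_of (sol s K p) = C, m_of (sol s K p) = 0 & w_of (sol s K p) = 0].

Definition admissible (k : nat) x s : Prop :=
  [/\ forall K i, poly_deg k (fun p => sol s K p i 0),
      forall K, poly_deg k (bot s K),
      forall K, 0 < vol s K,
      forall K p, triangle (elt conn x K) p -> 0 <= depth s K p &
      forall C, lake_at_rest x s C ->
        forall K e p, neighbor conn K e = None ->
          (exists2 r, 0 <= r <= 1 & p = edge_point (elt conn x K) e r) ->
          Ubd s K e p = vec3 C 0 0].

Definition alpha x xd s : R :=
  sup [set a | exists K e (i : 'I_3) (r : R), 0 <= r <= 1 /\
    let T := elt conn x K in
    let p := edge_point T e r in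
    let X := mesh_vel conn x xd K p in
    a = Num.max
      `|wave_speed g i (sol s K p) (depth s K p) X (outer_normal T e)|
      `|wave_speed g i (Uext s K e p) (hext s K e p) X (outer_normal T e)|].

Definition hstar_int s K e p : R :=
  Num.max 0 (eta_of (sol s K p) - Num.max (bot s K p) (Bext s K e p)).
Definition hstar_ext s K e p : R :=
  Num.max 0 (eta_of (Uext s K e p) - Num.max (bot s K p) (Bext s K e p)).

Definition flux_correction s K e p : 'M[R]_(3, 2) :=
  let d := g * eta_of (sol s K p) * (depth s K p - hstar_int s K e p) in
  mat32 [:: (0, 0); (d, 0); (0, d)].

Definition modified_flux x xd s K e p : 'cV[R]_3 :=
  let n := outer_normal (elt conn x K) e in
  let hi := hstar_int s K e p in
  let he := hstar_ext s K e p in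
  lax_friedrichs g (alpha x xd s)
    (recon (sol s K p) (depth s K p) hi) hi
    (recon (Uext s K e p) (hext s K e p) he) he
    (mesh_vel conn x xd K p) n
  + flux_correction s K e p *m col2 n.

(* The integrals are over the actual element, of vertices elt conn x K. *)
Definition residual x xd s phi K : 'cV[R]_3 :=
  let T := elt conn x K in
  \col_i
    (- (\sum_e int_edge T e (fun p => phi p * modified_flux x xd s K e p i 0))
     + int2 (triangle T) (fun p =>
         (fluxH g (sol s K p) (depth s K p) (mesh_vel conn x xd K p)
            *m col2 (dx phi p, dy phi p)) i 0)
     + int2 (triangle T) (fun p =>
         source g (fun q => eta_of (sol s K q)) (bot s K) p i 0 * phi p)).

(* The test function on K corresponding to phihat on the reference element. *)
Definition test_fun x phihat K : R * R -> R :=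
  phihat \o affmap (elt conn x K) Khat.

(* int_K U phi dx, computed on the reference element with the area vol s K. *)
Definition moment x s phi K : 'cV[R]_3 :=
  \col_i (vol s K / area (triangle Khat) *
    int2 (triangle Khat)
      ((fun p => sol s K p i 0 * phi p) \o affmap Khat (elt conn x K))).

(* The divergence of the mesh velocity on K, computed with the area vol s K. *)
Definition div_vel x xd s K : R :=
  let T := elt conn x K in
  (\sum_e int_edge T e (fun p =>
     let X := mesh_vel conn x xd K p in
     X.1 * (outer_normal T e).1 + X.2 * (outer_normal T e).2)) / vol s K.

End Scheme.

(* Main.v *)
Require Import Defs.
From mathcomp Require Import all_boot all_order all_algebra.
From mathcomp Require Import all_classical all_reals all_analysis.
From mathcomp Require Import measurable_realfun.
From mathcomp Require Import zify ring lra.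
Set Implicit Arguments.
Unset Strict Implicit.
Unset Printing Implicit Defensive.

Import Order.TTheory GRing.Theory Num.Theory.
Import numFieldNormedType.Exports.
Local Open Scope classical_set_scope.
Local Open Scope ring_scope.

(** At a lake at rest, (eta, m, w) = (C, 0, 0), and all moments of the solution
    are those of a constant, so it is enough to follow the constant C from one
    stage to the next.

    On an edge the interior and the exterior state are both (C, 0, 0), hence
    so are the two reconstructed states, with a common depth h'.  The
    dissipation alpha_h (U2 - U1) vanishes, and in the momentum equations the
    pressures g h' C - g C^2 / 2 and the correction g C (h - h') add up to the
    pressure g h C - g C^2 / 2 of the unreconstructed depth
    ([modified_flux_lake]).  Thus the numerical flux is the normal component
    of the flux H(U, h) that occurs inside the element, and the divergence
    theorem, in the form of an integration by parts against the test function
    ([weak_divergence]), leaves only the divergence of that flux and the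
    source ([residual_component]).  In the momentum equations these cancel,
    since h = C - B makes the pressure gradient equal to - g C grad B.  In the
    equation for eta the flux is - C times the mesh velocity, which is affine
    on the element: what is left, C times its constant divergence times the
    integral of the test function, is the change in the moment of C due to the
    increment that the update law prescribes for |K| ([residual_lake]).

    Since the earlier stages contribute the moments of C with their own areas
    ([moment_lake]), the moments of the new stage are those of C weighted by the
    updated area.  Testing with the difference between the solution and its
    supposed value, an admissible test function since P^k is stable under affine
    maps, shows that the integral of the square of this polynomial is zero, so
    that it vanishes on the element ([lake_of_moment]).  Three applications give
    the theorem.

    The analysis behind this is the divergence theorem and the affine change of
    variables for polynomials on a triangle.  Affine maps scale the plane
    Lebesgue measure by their determinant: this is checked on rectangles for
    triangular matrices and for the exchange of the coordinates, which together
    generate all of them.  Pulling back to the triangle u, v >= 0, u + v <= 1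
    reduces the divergence theorem to Fubini and the fundamental theorem of
    calculus. *)

(** * Affine maps and Lebesgue measure *)

(** Both sides are measures of [B], so it suffices to compare them on half-open
    intervals; the sign of [c] decides which end of the preimage is open. *)
Lemma lebesgue_measure_affine (R : realType) (c d : R) (B : set R) :
  c != 0 -> measurable B ->
  lebesgue_measure B =
  (`|c|%:E * lebesgue_measure ((fun x => c * x + d)%R @^-1` B))%E.
Proof.
move=> c0 mB.
pose phi : R -> measurableTypeR R := fun x => c * x + d.
have mphi : measurable_fun setT phi.
  by apply: measurable_funD => //; exact: measurable_funM.
pose nu := mscale (NngNum (normr_ge0 c))
  (pushforward (@lebesgue_measure R) phi).
suff H X : ocitv X -> lebesgue_measure X = nu mphi X.
  exact: (lebesgue_measure_unique H mB).
move=> [[a b]] _ <-.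
rewrite /nu /= /mscale /= {nu} /pushforward.
have nc : 0 < `|c| by rewrite normr_gt0.
have [c_lt0|c_ge0] := ltP c 0.
  have -> : phi @^-1` `]a, b] = `[(b - d) / c, (a - d) / c[%classic.
    apply/seteqP; split => x /=; rewrite !in_itv /= /phi;
      rewrite ler_ndivrMr// ltr_ndivlMr// !(mulrC x) => /andP[h1 h2];
      apply/andP; split; lra.
  rewrite !lebesgue_measure_itv /= !lte_fin.
  rewrite ltr_ndivrMr// mulrAC -mulrA divff ?lt_eqF// mulr1 ltrBlDr subrK.
  case: ifPn => _; last by rewrite mule0.
  rewrite -EFinM ltr0_norm//; congr (_%:E); field.
  by rewrite lt_eqF.
have c_gt0 : 0 < c by rewrite lt_def c0.
have -> : phi @^-1` `]a, b] = `](a - d) / c, (b - d) / c]%classic.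
  apply/seteqP; split => x /=; rewrite !in_itv /= /phi;
    rewrite ler_pdivlMr// ltr_pdivrMr// !(mulrC x) => /andP[h1 h2];
    apply/andP; split; lra.
rewrite !lebesgue_measure_itv /= !lte_fin.
rewrite ltr_pdivrMr// mulrAC -mulrA divff // mulr1 ltrBlDr subrK.
case: ifPn => _; last by rewrite mule0.
by rewrite -EFinM gtr0_norm//; congr (_%:E); field.
Qed.

(** The plane with the product of the Borel sigma-algebras carried by
    [lebesgue_measure]; on the bare type R * R another structure would
    be inferred, convertible to it only at great expense. *)
Notation mplane R := (measurableTypeR R * measurableTypeR R)%type.

(** The Jacobian [J] is put on the side of the preimage, so that it multiplies
    under composition and [phi] need not be known to be invertible. *)
Definition scales_area {R : realType} (phi : mplane R -> mplane R) (J : R) :=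
  measurable_fun setT phi /\
  forall E : set (mplane R), measurable E ->
    ((lebesgue_measure \x lebesgue_measure) E =
     J%:E * (lebesgue_measure \x lebesgue_measure) (phi @^-1` E))%E.

Lemma scales_area_comp (R : realType) (phi psi : mplane R -> mplane R)
    (J J' : R) :
  scales_area phi J -> scales_area psi J' ->
  scales_area (phi \o psi) (J * J').
Proof.
move=> [mphi sphi] [mpsi spsi]; split; first exact: measurableT_comp.
move=> E mE; rewrite sphi // spsi; first by rewrite muleA.
by rewrite -[X in measurable X]setTI; exact: mphi.
Qed.

(** A sigma-finite product measure is determined by its values on rectangles. *)
Lemma scales_area_product (R : realType) (phi : mplane R -> mplane R) (J : R) :
  0 <= J -> measurable_fun setT phi ->
  (forall A B : set (measurableTypeR R), measurable A -> measurable B ->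
    (lebesgue_measure A * lebesgue_measure B =
     J%:E * (lebesgue_measure \x lebesgue_measure) (phi @^-1` (A `*` B)))%E) ->
  scales_area phi J.
Proof.
move=> J0 mphi H; split => // E mE.
pose nu := mscale (NngNum J0)
  (pushforward (@lebesgue_measure R \x @lebesgue_measure R)%E phi).
suff H' A B : measurable A -> measurable B ->
    nu mphi (A `*` B) = (lebesgue_measure A * lebesgue_measure B)%E.
  exact: (product_measure_unique H' mE).
by move=> mA mB; rewrite H.
Qed.

Lemma scales_area_swap (R : realType) :
  scales_area (fun p : mplane R => (p.2, p.1)) 1.
Proof.
apply: scales_area_product => //; first exact: measurable_fun_pair.
move=> A B mA mB; rewrite mul1e.
rewrite (_ : _ @^-1` _ = B `*` A).
  by rewrite product_measure1E// muleC.
by apply/seteqP; split => -[x y] [] /=.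
Qed.

(** The vertical sections of the preimage of a rectangle are preimages of its
    second side under one-variable affine maps of the same slope [d]; only
    their offset depends on the section, and it does not change the length. *)
Lemma scales_area_lower (R : realType) (a b c d e : R) :
  a != 0 -> d != 0 ->
  scales_area (fun p : mplane R => (a * p.1 + b, c * p.1 + d * p.2 + e))
    `|a * d|.
Proof.
move=> a0 d0.
have mf : measurable_fun [set: mplane R]
   (fun p : mplane R => (a * p.1 + b, c * p.1 + d * p.2 + e)).
  apply: measurable_fun_pair.
    apply: measurable_funD => //; exact: measurable_funM.
  apply: measurable_funD => //; apply: measurable_funD;
    exact: measurable_funM.
apply: scales_area_product => // A B mA mB.
rewrite /product_measure1.
set phi := fun p : mplane R => _.
have H x : (lebesgue_measure \o xsection (phi @^-1` (A `*` B))) x =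
   ((\1_((fun x => a * x + b) @^-1` A) x)%:E *
    (`|d|^-1%:E * lebesgue_measure B))%E.
  rewrite /= indicE /=; have [xA|xA] := boolP (x \in _).
    rewrite mul1e (@lebesgue_measure_affine R d (c * x + e) B) //.
    rewrite muleA -EFinM mulVf ?normr_eq0// mul1e; congr (lebesgue_measure _).
    apply/seteqP; split => y /=; rewrite /xsection /= inE /phi /=.
      by move=> [_]; rewrite -addrA addrC -!addrA (addrC e).
    move=> h; split; first by move: xA; rewrite inE.
    by rewrite (_ : _ + _ = d * y + (c * x + e))//; ring.
  rewrite mul0e (_ : xsection _ _ = set0) ?measure0//.
  apply/seteqP; split => y //=; rewrite /xsection /= inE /phi /= => -[h _].
  by move: xA; rewrite notin_setE.
under eq_integral do rewrite H.
have mA' : measurable ((fun x => a * x + b) @^-1` A).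
  rewrite -[X in measurable X]setTI.
  have: measurable_fun setT (fun x : R => a * x + b).
    by apply: measurable_funD => //; exact: measurable_funM.
  exact.
have mI : measurable_fun [set: measurableTypeR R]
    (EFin \o (\1_((fun x => a * x + b) @^-1` A) : measurableTypeR R -> R)).
  by apply/measurable_EFinP; exact: measurable_indic.
rewrite ge0_integralZr//; last first.
  by rewrite mule_ge0// lee_fin invr_ge0.
rewrite integral_indic// setIT (@lebesgue_measure_affine R a b A) //.
rewrite normrM EFinM.
have nd0 : `|d| != 0 by rewrite normr_eq0.
rewrite -!muleA; congr (_ * _)%E; rewrite [RHS]muleCA; congr (_ * _)%E.
by rewrite muleA -EFinM divff// mul1e.
Qed.

(** A matrix with nonzero pivot [p] is the product of a lower triangular one and
    of an upper triangular one, the latter being lower triangular up to exchange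
    of the coordinates on both sides; if [p = 0], one exchange makes the matrix
    lower triangular. *)
Lemma scales_area_affine (R : realType) (p q r s b e : R) :
  p * s - q * r != 0 ->
  scales_area
    (fun z : mplane R => (p * z.1 + q * z.2 + b, r * z.1 + s * z.2 + e))
    `|p * s - q * r|.
Proof.
move=> det0; have [p0|p0] := eqVneq p 0.
  have [q0 r0] : q != 0 /\ r != 0.
    by move: det0; rewrite p0 mul0r sub0r oppr_eq0 mulf_eq0 negb_or => /andP[].
  have := scales_area_comp (scales_area_lower b s e q0 r0) (scales_area_swap R).
  rewrite mulr1 p0 mul0r sub0r normrN; congr scales_area.
  by apply/funext => z /=; congr pair; ring.
have d0 : s - r * q / p != 0.
  by apply: contra_neq det0 => h; rewrite (_ : _ - _ = p * (s - r * q / p));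
    [rewrite h mulr0 | field].
(* lower triangular factor, then the conjugate of one by the exchange *)
have := scales_area_comp (scales_area_lower b r e p0 d0)
  (scales_area_comp (scales_area_swap R)
    (scales_area_comp
      (scales_area_lower 0 (q / p) 0 (oner_neq0 R) (oner_neq0 R))
      (scales_area_swap R))).
rewrite !mulr1 normr1 !mulr1 (_ : p * (s - _) = p * s - q * r); last by field.
congr scales_area.
by apply/funext => z /=; congr pair; field.
Qed.

Lemma ge0_integral_scales_area (R : realType) (phi : mplane R -> mplane R)
    (J : R) (D : set (mplane R)) (f : mplane R -> \bar R) :
  0 <= J -> scales_area phi J -> measurable D ->
  measurable_fun setT f -> (forall p, (0 <= f p)%E) ->
  (\int[lebesgue_measure \x lebesgue_measure]_(p in D) f p =
   J%:E * \int[lebesgue_measure \x lebesgue_measure]_(p in phi @^-1` D)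
            (f \o phi) p)%E.
Proof.
move=> J0 [mphi sphi] mD mf f0.
have [nu [nuE <-]] : exists nu : {measure set (mplane R) -> \bar R},
    (forall A, nu A = (lebesgue_measure \x lebesgue_measure)%E (phi @^-1` A)) /\
    (\int[nu]_(p in D) f p =
     \int[lebesgue_measure \x lebesgue_measure]_(p in phi @^-1` D)
       (f \o phi) p)%E.
  pose nu := (pushforward (@lebesgue_measure R \x @lebesgue_measure R)%E phi
    : {measure set (mplane R) -> \bar R}).
  exists (nu mphi); split.
    by move=> A.
  apply: (ge0_integral_pushforward mphi) => //.
  exact: measurable_funTS.
rewrite -(ge0_integral_mscale nu mD (NngNum J0))//; last first.
  exact: measurable_funTS.
apply: eq_measure_integral => A mA _; rewrite /= /mscale /= nuE.
exact: sphi.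
Qed.

(** The signed version follows from the nonnegative one applied to the positive
    and the negative part; integrability keeps their difference meaningful. *)
Lemma Rintegral_scales_area (R : realType) (phi : mplane R -> mplane R)
    (J : R) (D : set (mplane R)) (f : mplane R -> R) :
  0 <= J -> scales_area phi J -> measurable D ->
  measurable_fun setT f ->
  (lebesgue_measure \x lebesgue_measure)%E.-integrable (phi @^-1` D)
    (EFin \o f \o phi) ->
  \int[(lebesgue_measure \x lebesgue_measure)%E]_(p in D) f p =
   J * \int[(lebesgue_measure \x lebesgue_measure)%E]_(p in phi @^-1` D)
         f (phi p).
Proof.
move=> J0 sphi mD mf intf.
have mEf : measurable_fun [set: mplane R] (EFin \o f) by exact/measurable_EFinP.
rewrite /Rintegral integralE [X in _ = J * fine X]integralE.
rewrite (ge0_integral_scales_area J0 sphi mD (measurable_funepos mEf))//.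
rewrite (ge0_integral_scales_area J0 sphi mD (measurable_funeneg mEf))//.
have mpD : measurable (phi @^-1` D).
  by rewrite -[X in measurable X]setTI; exact: sphi.1.
have pf := integrable_pos_fin_num mpD intf.
have nf := integrable_neg_fin_num mpD intf.
have fineJ (a b : \bar R) : (a \is a fin_num -> b \is a fin_num ->
    fine (J%:E * a - J%:E * b) = (J * fine (a - b))%R)%E.
  by move=> afin bfin; rewrite !fineB ?fin_numM// !fineM// mulrBr.
rewrite -(funepos_comp (EFin \o f) phi) -(funeneg_comp (EFin \o f) phi).
exact: (fineJ _ _ pf nf).
Qed.

(** * Polynomials of bounded total degree *)

(** Summing over a square of arbitrary size [N > k] removes the dependence of
    the inner range on the outer index, so that multiplication by a coordinate
    is a shift of the coefficients. *)
Lemma poly_degP (R : realType) (k : nat) (f : R * R -> R) :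
  poly_deg k f <-> exists2 c : nat -> nat -> R,
    (forall i j, (k < i + j)%N -> c i j = 0) &
    forall N p, (k < N)%N ->
      f p = \sum_(i < N) \sum_(j < N) c i j * p.1 ^+ i * p.2 ^+ j.
Proof.
split=> [[c fE]|[c c0 fE]]; last first.
  exists c => p; rewrite (fE k.+1)//; apply: eq_bigr => i _.
  rewrite [RHS](big_ord_widen k.+1
    (fun j => c i j * p.1 ^+ i * p.2 ^+ j)); last by lia.
  rewrite [RHS]big_mkcond /=; apply: eq_bigr => j _.
  by case: ifPn => // h; rewrite c0 ?mul0r//; lia.
exists (fun i j => if (i + j <= k)%N then c i j else 0).
  by move=> i j h; rewrite leqNgt h.
move=> N p kN; rewrite fE.
rewrite (big_ord_widen N
  (fun i => \sum_(j < (k - i).+1) c i j * p.1 ^+ i * p.2 ^+ j))//.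
rewrite [LHS]big_mkcond /=; apply: eq_bigr => i _.
case: ifPn => ik; last first.
  rewrite big1// => j _; rewrite ifF ?mul0r//; apply/negbTE; lia.
rewrite (big_ord_widen N (fun j => c i j * p.1 ^+ i * p.2 ^+ j)); last by lia.
rewrite big_mkcond /=; apply: eq_bigr => j _.
have -> : (j < (k - i).+1)%N = (i + j <= k)%N by lia.
by case: ifPn => // _; rewrite !mul0r.
Qed.

Lemma poly_deg_cst (R : realType) (k : nat) (a : R) : poly_deg k (fun=> a).
Proof.
apply/poly_degP; exists (fun i j => if (i + j == 0)%N then a else 0).
  by move=> i j h; rewrite ifF//; apply/negbTE; lia.
case=> // N p _; rewrite !big_ord_recl /= !big1 ?addr0.
- by rewrite !expr0 !mulr1.
- by move=> i _; rewrite big1// => j _; rewrite !mul0r.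
- by move=> j _; rewrite !mul0r.
Qed.

Lemma poly_deg_leq (R : realType) (k l : nat) (f : R * R -> R) :
  (k <= l)%N -> poly_deg k f -> poly_deg l f.
Proof.
move=> kl /poly_degP[c c0 fE]; apply/poly_degP; exists c.
  by move=> i j h; apply: c0; lia.
by move=> N p h; apply: fE; lia.
Qed.

Lemma poly_degD (R : realType) (k : nat) (f g : R * R -> R) :
  poly_deg k f -> poly_deg k g -> poly_deg k (fun p => f p + g p).
Proof.
move=> [c fE] [d gE]; exists (fun i j => c i j + d i j) => p.
rewrite fE gE -big_split; apply: eq_bigr => i _.
by rewrite -big_split; apply: eq_bigr => j _; rewrite !mulrDl.
Qed.

Lemma poly_degZ (R : realType) (k : nat) (a : R) (f : R * R -> R) :
  poly_deg k f -> poly_deg k (fun p => a * f p).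
Proof.
move=> [c fE]; exists (fun i j => a * c i j) => p.
rewrite fE big_distrr; apply: eq_bigr => i _.
by rewrite big_distrr; apply: eq_bigr => j _ /=; rewrite !mulrA.
Qed.

Lemma poly_deg_mulx (R : realType) (k : nat) (f : R * R -> R) :
  poly_deg k f -> poly_deg k.+1 (fun p => p.1 * f p).
Proof.
move=> /poly_degP[c c0 fE]; apply/poly_degP.
exists (fun i j => if i is i'.+1 then c i' j else 0).
  by case=> // i j h; apply: c0; lia.
case=> // N p h; rewrite (fE N)// [RHS]big_ord_recl /=.
rewrite [X in _ = X + _]big1 ?add0r; last first.
  by move=> j _; rewrite !mul0r.
rewrite big_distrr; apply: eq_bigr => i _ /=.
rewrite [RHS]big_ord_recr /= c0 ?mul0r ?addr0; last by lia.
rewrite big_distrr; apply: eq_bigr => j _ /=.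
by rewrite exprS; ring.
Qed.

Lemma poly_deg_muly (R : realType) (k : nat) (f : R * R -> R) :
  poly_deg k f -> poly_deg k.+1 (fun p => p.2 * f p).
Proof.
move=> /poly_degP[c c0 fE]; apply/poly_degP.
exists (fun i j => if j is j'.+1 then c i j' else 0).
  by move=> i [|j]// h; apply: c0; lia.
case=> // N p h; rewrite (fE N)// [RHS]big_ord_recr /=.
rewrite [X in _ = _ + X]big1 ?addr0; last first.
  by move=> [[|j] jN] _ /=; rewrite ?mul0r// c0 ?mul0r//; lia.
rewrite big_distrr; apply: eq_bigr => i _ /=.
rewrite [RHS]big_ord_recl /= !mul0r add0r.
rewrite big_distrr; apply: eq_bigr => j _ /=.
by rewrite exprS; ring.
Qed.

Definition affine (R : realType) (f : R * R -> R) :=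
  exists a b c : R, forall p, f p = a + b * p.1 + c * p.2.

Lemma poly_deg_mul_affine (R : realType) (k : nat) (l f : R * R -> R) :
  affine l -> poly_deg k f -> poly_deg k.+1 (fun p => l p * f p).
Proof.
move=> [a [b [c lE]]] pf.
rewrite (_ : (fun _ => _) =
  (fun p => a * f p + (b * (p.1 * f p) + c * (p.2 * f p)))); last first.
  by apply/funext => p; rewrite lE; ring.
apply: poly_degD; first by apply: poly_degZ; apply: poly_deg_leq pf.
by apply: poly_degD; apply: poly_degZ;
  [apply: poly_deg_mulx|apply: poly_deg_muly].
Qed.

(** Substituting affine forms turns a monomial of degree [i + j] into a product
    of [i + j] affine forms. *)
Lemma poly_deg_comp_affine (R : realType) (k : nat) (l1 l2 f : R * R -> R) :
  affine l1 -> affine l2 -> poly_deg k f ->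
  poly_deg k (fun p => f (l1 p, l2 p)).
Proof.
move=> al1 al2 [c fE].
have pm i j : poly_deg (i + j) (fun p => l1 p ^+ i * l2 p ^+ j).
  elim: i => [|i IH].
    elim: j => [|j IH].
      by under eq_fun do rewrite !expr0 mulr1; exact: poly_deg_cst.
    rewrite (_ : (fun _ => _) = (fun p => l2 p * (l1 p ^+ 0 * l2 p ^+ j))).
      exact: poly_deg_mul_affine.
    by apply/funext => p; rewrite !expr0 exprS; ring.
  rewrite (_ : (fun _ => _) = (fun p => l1 p * (l1 p ^+ i * l2 p ^+ j))).
    exact: poly_deg_mul_affine.
  by apply/funext => p; rewrite exprS; ring.
have psum (n : nat) (F : 'I_n -> R * R -> R) :
    (forall i, poly_deg k (F i)) -> poly_deg k (fun p => \sum_i F i p).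
  elim: n F => [|n IH] F H.
    by under eq_fun do rewrite big_ord0; exact: poly_deg_cst.
  by under eq_fun do rewrite big_ord_recl; apply: poly_degD => //; exact: IH.
under eq_fun do rewrite fE /=.
apply: (psum) => i; apply: (psum) => j.
under eq_fun do rewrite -mulrA.
apply: poly_degZ; apply: poly_deg_leq (pm i j).
by have := ltn_ord i; have := ltn_ord j; lia.
Qed.

(** * Polynomial functions of two variables *)

(** Polynomials of any degree, as the functions generated by constants and
    coordinates: analytic facts about them then follow by induction. *)
Inductive polyfun (R : realType) : (R * R -> R) -> Prop :=
| polyfun_cst c : polyfun (fun=> c)
| polyfun_fst : polyfun (fun p => p.1)
| polyfun_snd : polyfun (fun p => p.2)
| polyfunD f g : polyfun f -> polyfun g -> polyfun (fun p => f p + g p)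
| polyfunM f g : polyfun f -> polyfun g -> polyfun (fun p => f p * g p).

Lemma polyfun_sum (R : realType) (n : nat) (F : 'I_n -> R * R -> R) :
  (forall i, polyfun (F i)) -> polyfun (fun p => \sum_i F i p).
Proof.
elim: n F => [|n IH] F H.
  by under eq_fun do rewrite big_ord0; exact: polyfun_cst.
by under eq_fun do rewrite big_ord_recl; apply: polyfunD => //; exact: IH.
Qed.

Lemma polyfun_poly_deg (R : realType) (k : nat) (f : R * R -> R) :
  poly_deg k f -> polyfun f.
Proof.
move=> [c fE]; have -> := funext fE.
have pX (h : R * R -> R) n : polyfun h -> polyfun (fun p => h p ^+ n).
  move=> ph; elim: n => [|n IH].
    by under eq_fun do rewrite expr0; exact: polyfun_cst.
  by under eq_fun do rewrite exprS; exact: polyfunM.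
apply: polyfun_sum => i; apply: polyfun_sum => j.
apply: polyfunM; last exact/pX/polyfun_snd.
apply: polyfunM; last exact/pX/polyfun_fst.
exact: polyfun_cst.
Qed.

Lemma polyfun_affine (R : realType) (f : R * R -> R) : affine f -> polyfun f.
Proof.
move=> [a [b [c fE]]]; have -> := funext fE.
apply: polyfunD; [apply: polyfunD|]; [|apply: polyfunM|apply: polyfunM];
  by [exact: polyfun_cst|exact: polyfun_fst|exact: polyfun_snd].
Qed.

Lemma polyfun_comp (R : realType) (f a b : R * R -> R) :
  polyfun f -> polyfun a -> polyfun b -> polyfun (fun p => f (a p, b p)).
Proof.
move=> + pa pb; elim=> [c|||{}f g _ pf _ pg|{}f g _ pf _ pg] //=.
- exact: polyfun_cst.
- exact: polyfunD.
- exact: polyfunM.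
Qed.

Lemma polyfun_comp_continuous (R : realType) (T : topologicalType)
    (f : R * R -> R) (a b : T -> R) :
  polyfun f -> continuous a -> continuous b ->
  continuous (fun t => f (a t, b t)).
Proof.
move=> + ca cb; elim=> [c|||{}f g _ pf _ pg|{}f g _ pf _ pg] x /=.
- exact: cvg_cst.
- exact: ca.
- exact: cb.
- by apply: cvgD; [exact: pf|exact: pg].
- by apply: cvgM; [exact: pf|exact: pg].
Qed.

Lemma polyfun_measurable (R : realType) (f : R * R -> R) :
  polyfun f -> measurable_fun [set: mplane R] f.
Proof.
elim=> [c|||{}f g _ pf _ pg|{}f g _ pf _ pg].
- exact: measurable_cst.
- exact: measurable_fst.
- exact: measurable_snd.
- exact: (@measurable_funD _ (mplane R) R setT f g pf pg).
- exact: (@measurable_funM _ (mplane R) R setT f g pf pg).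
Qed.

Lemma polyfun_bounded (R : realType) (f : R * R -> R) :
  polyfun f -> forall r, exists M, forall p,
    `|p.1| <= r -> `|p.2| <= r -> `|f p| <= M.
Proof.
move=> pf r.
elim: pf => [c|||{}f g _ [M pf] _ [N pg]|{}f g _ [M pf] _ [N pg]] //.
- by exists `|c|.
- by exists r.
- by exists r.
- exists (M + N) => p p1 p2; apply: (le_trans (ler_normD _ _)).
  by apply: lerD; [exact: pf|exact: pg].
- exists (M * N) => p p1 p2; rewrite normrM.
  by apply: ler_pM => //; [exact: pf|exact: pg].
Qed.

(** The chain rule along an arbitrary plane curve.  Partial derivatives and
    derivatives along edges are instances, and, unlike the mere existence of
    partial derivatives, the property is stable under affine substitution. *)
Definition has_gradient (R : realType) (f fx fy : R * R -> R) :=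
  forall (c1 c2 : R -> R) (d1 d2 s : R),
    is_derive s 1 c1 d1 -> is_derive s 1 c2 d2 ->
    is_derive s 1 (fun t => f (c1 t, c2 t))
      (fx (c1 s, c2 s) * d1 + fy (c1 s, c2 s) * d2).

Lemma has_gradientD (R : realType) (f fx fy g gx gy : R * R -> R) :
  has_gradient f fx fy -> has_gradient g gx gy ->
  has_gradient (fun p => f p + g p) (fun p => fx p + gx p)
    (fun p => fy p + gy p).
Proof.
move=> hf hg c1 c2 d1 d2 s h1 h2.
have := is_deriveD (hf _ _ _ _ _ h1 h2) (hg _ _ _ _ _ h1 h2).
by move=> /is_derive_eq; apply; ring.
Qed.

Lemma has_gradientM (R : realType) (f fx fy g gx gy : R * R -> R) :
  has_gradient f fx fy -> has_gradient g gx gy ->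
  has_gradient (fun p => f p * g p) (fun p => fx p * g p + f p * gx p)
    (fun p => fy p * g p + f p * gy p).
Proof.
move=> hf hg c1 c2 d1 d2 s h1 h2.
have := is_deriveM (hf _ _ _ _ _ h1 h2) (hg _ _ _ _ _ h1 h2).
by move=> /is_derive_eq; apply; rewrite /GRing.scale /=; ring.
Qed.

Lemma has_gradient_affine (R : realType) (f : R * R -> R) (a b c : R) :
  (forall p, f p = a + b * p.1 + c * p.2) ->
  has_gradient f (fun=> b) (fun=> c).
Proof.
move=> fE c1 c2 d1 d2 s h1 h2.
have := is_deriveD (is_deriveD (is_derive_cst a s 1) (is_deriveZ b h1))
  (is_deriveZ c h2).
rewrite add0r /=; congr (is_derive _ _ _).
by apply/funext => t /=; rewrite fE.
Qed.

Lemma polyfun_gradient (R : realType) (f : R * R -> R) :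
  polyfun f -> exists fx fy,
    [/\ polyfun fx, polyfun fy & has_gradient f fx fy].
Proof.
elim=> [c|||{}f g pf [fx [fy [pfx pfy hf]]] pg [gx [gy [pgx pgy hg]]]
  |{}f g pf [fx [fy [pfx pfy hf]]] pg [gx [gy [pgx pgy hg]]]].
- exists (fun=> 0), (fun=> 0); split; try exact: polyfun_cst.
  by apply: (@has_gradient_affine _ _ c) => p; rewrite !mul0r !addr0.
- exists (fun=> 1), (fun=> 0); split; try exact: polyfun_cst.
  by apply: (@has_gradient_affine _ _ 0) => p; rewrite mul0r mul1r add0r addr0.
- exists (fun=> 0), (fun=> 1); split; try exact: polyfun_cst.
  by apply: (@has_gradient_affine _ _ 0) => p; rewrite mul0r mul1r !add0r.
- exists (fun p => fx p + gx p), (fun p => fy p + gy p).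
  by split; [exact: polyfunD|exact: polyfunD|exact: has_gradientD].
- exists (fun p => fx p * g p + f p * gx p), (fun p => fy p * g p + f p * gy p).
  by split; [apply: polyfunD; exact: polyfunM|apply: polyfunD; exact: polyfunM|
    exact: has_gradientM].
Qed.

Lemma has_gradient_dx (R : realType) (f fx fy : R * R -> R) :
  has_gradient f fx fy -> dx f = fx.
Proof.
move=> hf; apply/funext => -[x y]; rewrite /dx derive1E /=.
have := hf _ _ _ _ _ (is_derive_id x 1) (is_derive_cst y x 1).
by rewrite mulr1 mulr0 addr0 => /@derive_val.
Qed.

Lemma has_gradient_dy (R : realType) (f fx fy : R * R -> R) :
  has_gradient f fx fy -> dy f = fy.
Proof.
move=> hf; apply/funext => -[x y]; rewrite /dy derive1E /=.
have := hf _ _ _ _ _ (is_derive_cst x y 1) (is_derive_id y 1).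
by rewrite mulr1 mulr0 add0r => /@derive_val.
Qed.

(** The degenerate interval [a = b] is included: it occurs for the slice of a
    triangle through a vertex. *)
Lemma integral_FTC (R : realType) (F f : R -> R) (a b : R) :
  a <= b -> (forall x, is_derive x (1 : R) F (f x)) -> continuous f ->
  (\int[lebesgue_measure]_(x in `[a, b]) (f x)%:E = (F b - F a)%:E)%E.
Proof.
rewrite le_eqVlt => /predU1P[<- _ _|ab dF cf].
  by rewrite set_itv1 integral_set1 subrr.
have cF : continuous F.
  move=> x; have [dFx _] := dF x.
  by apply: differentiable_continuous; exact/derivable1_diffP.
rewrite (@continuous_FTC2 _ _ F)//.
- by apply: continuous_subspaceT.
- split=> [x _||].
  + by have [] := dF x.
  + exact/cvg_at_right_filter/cF.
  + exact/cvg_at_left_filter/cF.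
- by move=> x _; rewrite derive1E; apply/derive_val.
Qed.

(** * The reference triangle *)

Definition ref_triangle (R : realType) : set (mplane R) :=
  [set p | [/\ 0 <= p.1, 0 <= p.2 & p.1 + p.2 <= 1]].
Arguments ref_triangle R : clear implicits.

Lemma measurable_ref_triangle (R : realType) : measurable (ref_triangle R).
Proof.
pose sum : mplane R -> R := fun p => p.1 + p.2.
have msum : measurable_fun [set: mplane R] sum.
  by apply: polyfun_measurable; apply: polyfunD;
    [exact: polyfun_fst|exact: polyfun_snd].
rewrite (_ : ref_triangle R =
  ((fst : mplane R -> _) @^-1` `[0, +oo[) `&`
  ((snd : mplane R -> _) @^-1` `[0, +oo[) `&` (sum @^-1` `]-oo, 1])).
  apply: measurableI; [apply: measurableI|];
    rewrite -[X in measurable X]setTI.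
  - by apply: measurable_fst => //; exact: measurable_itv.
  - by apply: measurable_snd => //; exact: measurable_itv.
  - by apply: msum => //; exact: measurable_itv.
apply/seteqP; split => p /=; rewrite !in_itv /= !andbT; first by case.
by move=> [[]].
Qed.

Lemma ref_triangle_finite (R : realType) :
  ((lebesgue_measure \x lebesgue_measure) (ref_triangle R) < +oo)%E.
Proof.
pose Q : set (mplane R) := `[0, 1]%classic `*` `[0, 1]%classic.
have mQ : measurable Q by apply: measurableX; exact: measurable_itv.
apply: (@le_lt_trans _ _ ((lebesgue_measure \x lebesgue_measure)%E Q)).
  apply: le_measure; rewrite ?inE//; first exact: measurable_ref_triangle.
  move=> [x y] [/= x0 y0 xy].
  by split; rewrite /= in_itv /=; apply/andP; split; lra.
rewrite /Q product_measure1E; [|exact: measurable_itv|exact: measurable_itv].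
have l1 : lebesgue_measure (`[0, 1]%classic : set R) = 1%E.
  by rewrite lebesgue_measure_itv /= lte_fin ltr01 -EFinB subr0.
by rewrite [X in (X * _)%E]l1 [X in (_ * X)%E]l1 mule1 ltry.
Qed.

Lemma integrable_ref_triangle (R : realType) (f : R * R -> R) :
  polyfun f ->
  (lebesgue_measure \x lebesgue_measure)%E.-integrable (ref_triangle R)
    (EFin \o f).
Proof.
move=> pf; apply: measurable_bounded_integrable.
- exact: measurable_ref_triangle.
- exact: ref_triangle_finite.
- by apply: measurable_funTS; exact: polyfun_measurable.
have [M fM] := polyfun_bounded pf 1.
exists M; split; first exact: num_real.
move=> N MN p [p0 p1 p01]; apply: le_trans (ltW MN).
by apply: fM; rewrite ger0_norm//; lra.
Qed.

Lemma int2D_ref (R : realType) (f h : R * R -> R) :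
  polyfun f -> polyfun h ->
  int2 (ref_triangle R) (fun p => f p + h p) =
  int2 (ref_triangle R) f + int2 (ref_triangle R) h.
Proof.
move=> pf ph; apply: RintegralD; first exact: measurable_ref_triangle.
  exact: integrable_ref_triangle.
exact: integrable_ref_triangle.
Qed.

Lemma int2Zr_ref (R : realType) (a : R) (f : R * R -> R) :
  polyfun f ->
  int2 (ref_triangle R) (fun p => f p * a) = int2 (ref_triangle R) f * a.
Proof.
move=> pf; apply: RintegralZr; first exact: measurable_ref_triangle.
exact: integrable_ref_triangle.
Qed.

(** Exchanging the coordinates preserves area and the reference triangle. *)
Lemma int2_ref_triangle_swap (R : realType) (f : R * R -> R) :
  polyfun f ->
  int2 (ref_triangle R) f = int2 (ref_triangle R) (fun p => f (p.2, p.1)).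
Proof.
move=> pf; rewrite /int2.
rewrite (Rintegral_scales_area ler01 (scales_area_swap R)
  (@measurable_ref_triangle R) (polyfun_measurable pf)).
  rewrite mul1r; congr Rintegral.
  by apply/seteqP; split => -[x y] [/= ? ? ?]; split => //=; lra.
rewrite (_ : _ @^-1` _ = ref_triangle R).
  apply: (@integrable_ref_triangle _ (fun p => f (p.2, p.1))).
  by apply: polyfun_comp => //; [exact: polyfun_snd|exact: polyfun_fst].
by apply/seteqP; split => -[x y] [/= ? ? ?]; split => //=; lra.
Qed.

(** Fubini, then the fundamental theorem of calculus on the vertical slice
    [[0, 1 - x]]. *)
Lemma int2_ref_triangle_dy (R : realType) (f fx fy : R * R -> R) :
  polyfun f -> polyfun fy -> has_gradient f fx fy ->
  int2 (ref_triangle R) fy =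
  \int[lebesgue_measure]_(x in `[0, 1]) (f (x, 1 - x) - f (x, 0)).
Proof.
move=> pf pfy hf.
have ify := integrable_ref_triangle pfy.
rewrite /int2 /Rintegral integral_mkcond -integral12_prod_meas1; last first.
  by rewrite -integrable_mkcond//; exact: measurable_ref_triangle.
congr fine; rewrite [RHS]integral_mkcond; apply: eq_integral => x _.
rewrite /fubini_F patchE; case: ifPn => [|];
  rewrite /= ?notin_setE ?inE /= in_itv /=.
  move=> /andP[x0 x1].
  have dF (y : R) : is_derive y (1 : R) (fun t => f (x, t)) (fy (x, y)).
    have := hf _ _ _ _ _ (is_derive_cst x y 1) (is_derive_id y 1).
    by rewrite mulr1 mulr0 add0r.
  have cf : continuous (fun y => fy (x, y)).
    by apply: polyfun_comp_continuous => // y; [exact: cvg_cst|exact: cvg_id].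
  have x1' : 0 <= 1 - x by lra.
  rewrite -(integral_FTC x1' dF cf) [RHS]integral_mkcond.
  apply: eq_integral => y _; rewrite !patchE.
  suff -> : ((x, y) \in ref_triangle R) = (y \in `[0, 1 - x]%classic) by [].
  apply/idP/idP; rewrite !inE /= in_itv /=.
    by move=> [/= _ y0 xy]; apply/andP; split; lra.
  by move=> /andP[y0 xy]; split => //=; lra.
move=> /negP xn; rewrite integral0_eq// => y _; rewrite patchE ifF//.
by apply/negbTE; rewrite notin_setE => -[/= x0 y0 xy]; move/negP: xn; apply;
  apply/andP; split; lra.
Qed.

Lemma int2_ref_triangle_dx (R : realType) (f fx fy : R * R -> R) :
  polyfun f -> polyfun fx -> has_gradient f fx fy ->
  int2 (ref_triangle R) fx =
  \int[lebesgue_measure]_(y in `[0, 1]) (f (1 - y, y) - f (0, y)).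
Proof.
move=> pf pfx hf; rewrite int2_ref_triangle_swap//.
have psw h : polyfun h -> polyfun (fun p : R * R => h (p.2, p.1)).
  by move=> ph; apply: polyfun_comp => //;
    [exact: polyfun_snd|exact: polyfun_fst].
rewrite (@int2_ref_triangle_dy _ (fun p => f (p.2, p.1))
  (fun p => fy (p.2, p.1)))//.
- exact: psw.
- exact: psw.
- move=> c1 c2 d1 d2 s h1 h2 /=; rewrite addrC; exact: hf.
Qed.

(** * Triangles and their barycentric coordinates *)

Lemma ordS3_0 : ordS (0 : 'I_3) = 1. Proof. exact: val_inj. Qed.
Lemma ordS3_1 : ordS (1 : 'I_3) = 2%:R. Proof. exact: val_inj. Qed.
Lemma ordS3_2 : ordS (2%:R : 'I_3) = 0. Proof. exact: val_inj. Qed.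
Definition ordS3E := (ordS3_0, ordS3_1, ordS3_2).

Lemma big_ord3 (V : nmodType) (F : 'I_3 -> V) :
  \sum_a F a = F 0 + F 1 + F 2%:R.
Proof.
rewrite !big_ord_recl big_ord0 addr0 addrA.
by congr (F _ + F _ + F _); apply: val_inj.
Qed.

Lemma ord3_ind (P : 'I_3 -> Prop) : P 0 -> P 1 -> P 2%:R -> forall a, P a.
Proof.
move=> P0 P1 P2 [[|[|[|n]]] h] //.
- by rewrite (_ : Ordinal h = 0)//; apply: val_inj.
- by rewrite (_ : Ordinal h = 1)//; apply: val_inj.
- by rewrite (_ : Ordinal h = 2%:R)//; apply: val_inj.
Qed.

Lemma baryE (R : realType) (T : 'I_3 -> R * R) (p : R * R) :
  [/\ bary T 0 p = cross (T 2%:R - T 1) (p - T 1) / det3 T,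
      bary T 1 p = cross (T 0 - T 2%:R) (p - T 2%:R) / det3 T &
      bary T 2%:R p = cross (T 1 - T 0) (p - T 0) / det3 T].
Proof. by rewrite /bary !ordS3E. Qed.

(** The affine parametrization of the triangle [T] by the reference triangle. *)
Definition simplex (R : realType) (T : 'I_3 -> R * R) (q : mplane R) :
    mplane R :=
  ((1 - q.1 - q.2) * (T 0).1 + q.1 * (T 1).1 + q.2 * (T 2%:R).1,
   (1 - q.1 - q.2) * (T 0).2 + q.1 * (T 1).2 + q.2 * (T 2%:R).2).

Lemma bary_simplex (R : realType) (T : 'I_3 -> R * R) (q : R * R) :
  nondegenerate_triangle T ->
  [/\ bary T 0 (simplex T q) = 1 - q.1 - q.2, bary T 1 (simplex T q) = q.1 &
      bary T 2%:R (simplex T q) = q.2].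
Proof.
rewrite /nondegenerate_triangle; have [-> -> ->] := baryE T (simplex T q).
rewrite /simplex /det3 /cross /=.
case: (T 0) => x0 y0; case: (T 1) => x1 y1; case: (T 2%:R) => x2 y2 /= h.
by split; field.
Qed.

Lemma simplex_bary (R : realType) (T : 'I_3 -> R * R) (p : R * R) :
  nondegenerate_triangle T ->
  bary T 0 p = 1 - bary T 1 p - bary T 2%:R p /\
  simplex T (bary T 1 p, bary T 2%:R p) = p.
Proof.
rewrite /nondegenerate_triangle; have [-> -> ->] := baryE T p.
rewrite /simplex /det3 /cross /=.
case: (T 0) => x0 y0; case: (T 1) => x1 y1; case: (T 2%:R) => x2 y2.
by case: p => x y /= h; split; last congr pair; field.
Qed.

Lemma simplex_inj (R : realType) (T : 'I_3 -> R * R) :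
  nondegenerate_triangle T -> injective (simplex T).
Proof.
move=> nT [x y] [x' y'] h.
have [_ /= b1 b2] := bary_simplex (x, y) nT.
have [_ /= b1' b2'] := bary_simplex (x', y') nT.
by congr pair; [rewrite -b1 h b1'|rewrite -b2 h b2'].
Qed.

(** The weights of a convex combination of the vertices are its barycentric
    coordinates, because [simplex T] is injective. *)
Lemma triangle_simplex (R : realType) (T : 'I_3 -> R * R) (q : R * R) :
  nondegenerate_triangle T ->
  triangle T (simplex T q) <-> ref_triangle R q.
Proof.
move=> nT; split.
  move=> [c [c0 _]]; rewrite !big_ord3 => c1 p1 p2.
  have qE : q = (c 1, c 2%:R).
    apply: (simplex_inj nT); rewrite (surjective_pairing (simplex T q)) p1 p2.
    by rewrite /simplex /= -!c1; congr pair; ring.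
  rewrite qE; split => //=.
  have := c0 0; lra.
move=> [q1 q2 q12].
exists (fun a => bary T a (simplex T q)).
have [b0 b1 b2] := bary_simplex q nT.
split=> [||||].
- by apply: ord3_ind; rewrite ?b0 ?b1 ?b2//; lra.
- by move=> i; rewrite inE.
- by rewrite big_ord3 b0 b1 b2; ring.
- by rewrite big_ord3 b0 b1 b2.
- by rewrite big_ord3 b0 b1 b2.
Qed.

Lemma affine_bary (R : realType) (T : 'I_3 -> R * R) (a : 'I_3) :
  affine (bary T a).
Proof.
rewrite /bary /cross /affine; move: (ordS a) (ordS (ordS a)) => i j.
exists ((- ((T j - T i).1 * (T i).2) + (T j - T i).2 * (T i).1) / det3 T),
 (- (T j - T i).2 / det3 T), ((T j - T i).1 / det3 T) => p /=.
by ring.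
Qed.

Lemma affine_affmap (R : realType) (S T : 'I_3 -> R * R) :
  affine (fun p => (affmap S T p).1) /\ affine (fun p => (affmap S T p).2).
Proof.
have [a0 [b0 [c0 E0]]] := affine_bary S 0.
have [a1 [b1 [c1 E1]]] := affine_bary S 1.
have [a2 [b2 [c2 E2]]] := affine_bary S 2%:R.
rewrite /affmap; split.
  exists (a0 * (T 0).1 + a1 * (T 1).1 + a2 * (T 2%:R).1),
    (b0 * (T 0).1 + b1 * (T 1).1 + b2 * (T 2%:R).1),
    (c0 * (T 0).1 + c1 * (T 1).1 + c2 * (T 2%:R).1) => p /=.
  by rewrite big_ord3 E0 E1 E2; ring.
exists (a0 * (T 0).2 + a1 * (T 1).2 + a2 * (T 2%:R).2),
  (b0 * (T 0).2 + b1 * (T 1).2 + b2 * (T 2%:R).2),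
  (c0 * (T 0).2 + c1 * (T 1).2 + c2 * (T 2%:R).2) => p /=.
by rewrite big_ord3 E0 E1 E2; ring.
Qed.

Lemma polyfun_affmap (R : realType) (S T : 'I_3 -> R * R) (f : R * R -> R) :
  polyfun f -> polyfun (f \o affmap S T).
Proof.
have [aff1 aff2] := affine_affmap S T; move=> pf.
exact: (polyfun_comp pf (polyfun_affine aff1) (polyfun_affine aff2)).
Qed.

Lemma affmap_simplex (R : realType) (S T : 'I_3 -> R * R) (q : R * R) :
  nondegenerate_triangle S -> affmap S T (simplex S q) = simplex T q.
Proof.
move=> nS; rewrite /affmap !big_ord3.
by have [-> -> ->] := bary_simplex q nS.
Qed.

Lemma simplex_surj (R : realType) (T : 'I_3 -> R * R) (p : R * R) :
  nondegenerate_triangle T -> exists q, p = simplex T q.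
Proof.
move=> nT; exists (bary T 1 p, bary T 2%:R p).
by have [_ ->] := simplex_bary p nT.
Qed.

Lemma affmapK (R : realType) (S T : 'I_3 -> R * R) :
  nondegenerate_triangle S -> nondegenerate_triangle T ->
  cancel (affmap S T) (affmap T S).
Proof.
by move=> nS nT p; have [q ->] := simplex_surj p nS; rewrite !affmap_simplex.
Qed.

Lemma simplex_affine (R : realType) (T : 'I_3 -> R * R) :
  (forall q, (simplex T q).1 = (T 0).1 + ((T 1).1 - (T 0).1) * q.1 +
     ((T 2%:R).1 - (T 0).1) * q.2) /\
  (forall q, (simplex T q).2 = (T 0).2 + ((T 1).2 - (T 0).2) * q.1 +
     ((T 2%:R).2 - (T 0).2) * q.2).
Proof. by split=> q; rewrite /simplex /=; ring. Qed.

Lemma polyfun_simplex (R : realType) (T : 'I_3 -> R * R) (f : R * R -> R) :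
  polyfun f -> polyfun (f \o simplex T).
Proof.
have [E1 E2] := simplex_affine T.
move=> pf; apply: (polyfun_comp pf); apply: polyfun_affine.
  exists (T 0).1, ((T 1).1 - (T 0).1), ((T 2%:R).1 - (T 0).1) => q.
  by rewrite -E1.
exists (T 0).2, ((T 1).2 - (T 0).2), ((T 2%:R).2 - (T 0).2) => q.
by rewrite -E2.
Qed.

Lemma scales_area_simplex (R : realType) (T : 'I_3 -> R * R) :
  nondegenerate_triangle T -> scales_area (simplex T) `|det3 T|.
Proof.
move=> nT.
have dE : det3 T = ((T 1).1 - (T 0).1) * ((T 2%:R).2 - (T 0).2) -
   ((T 2%:R).1 - (T 0).1) * ((T 1).2 - (T 0).2).
  by rewrite /det3 /cross /=; ring.
have := @scales_area_affine R ((T 1).1 - (T 0).1) ((T 2%:R).1 - (T 0).1)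
  ((T 1).2 - (T 0).2) ((T 2%:R).2 - (T 0).2) (T 0).1 (T 0).2.
rewrite -dE => /(_ nT); congr scales_area.
by apply/funext => q; rewrite /simplex; congr pair; ring.
Qed.

(** The triangle is the preimage of the reference triangle under barycentric
    coordinates, which are polynomial hence measurable. *)
Lemma measurable_triangle (R : realType) (T : 'I_3 -> R * R) :
  nondegenerate_triangle T -> measurable (triangle T : set (mplane R)).
Proof.
move=> nT.
pose b : mplane R -> mplane R := fun p => (bary T 1 p, bary T 2%:R p).
have mb : measurable_fun setT b.
  by apply: measurable_fun_pair; apply: polyfun_measurable;
    apply: polyfun_affine; exact: affine_bary.
rewrite (_ : triangle T = b @^-1` ref_triangle R).
  rewrite -[X in measurable X]setTI; apply: mb => //.
  exact: measurable_ref_triangle.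
apply/seteqP; split => p; have [_ bp] := simplex_bary p nT.
  by rewrite -{1}bp => /(triangle_simplex _ nT).
by move=> h; rewrite -bp; apply/(triangle_simplex _ nT).
Qed.

Lemma int2_triangle (R : realType) (T : 'I_3 -> R * R) (f : R * R -> R) :
  nondegenerate_triangle T -> polyfun f ->
  int2 (triangle T) f = `|det3 T| * int2 (ref_triangle R) (f \o simplex T).
Proof.
move=> nT pf.
have pE : simplex T @^-1` triangle T = ref_triangle R.
  by apply/seteqP; split => q /=; move/(triangle_simplex _ nT).
rewrite /int2 (Rintegral_scales_area (normr_ge0 _) (scales_area_simplex nT)
  (measurable_triangle nT) (polyfun_measurable pf)) pE//.
exact: (integrable_ref_triangle (polyfun_simplex T pf)).
Qed.

(** * The divergence theorem on a triangle *)

Lemma continuous_itv01_integrable (R : realType) (f : R -> R) :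
  continuous f ->
  (@lebesgue_measure R).-integrable `[0, 1] (EFin \o f).
Proof.
move=> cf; apply: continuous_compact_integrable; first exact: segment_compact.
exact: continuous_subspaceT.
Qed.

Lemma Rintegral01_flip (R : realType) (f : R -> R) :
  continuous f ->
  \int[lebesgue_measure]_(s in `[0, 1]) f (1 - s) =
  \int[lebesgue_measure]_(s in `[0, 1]) f s.
Proof.
move=> cf; rewrite (@Rintegration_by_substitution_onem _ f 1).
- by rewrite unstable.onem1.
- by rewrite ler01 lexx.
- exact: continuous_subspaceT.
Qed.

(** The mean of [f] over the edge [e].  Unlike the line integral it does not
    contain the edge length, which cancels that of the unit normal. *)
Definition edge_mean (R : realType) (T : 'I_3 -> R * R) (e : 'I_3)
    (f : R * R -> R) : R :=
  \int[lebesgue_measure]_(s in `[0, 1]) f (edge_point T e s).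

Lemma continuous_edge (R : realType) (T : 'I_3 -> R * R) (e : 'I_3)
    (f : R * R -> R) : polyfun f -> continuous (fun s => f (edge_point T e s)).
Proof.
have cl (a b : R) : continuous (fun s : R => (1 - s) * a + s * b).
  move=> s; apply: cvgD; apply: cvgM.
  - by apply: cvgB; [exact: cvg_cst|exact: cvg_id].
  - exact: cvg_cst.
  - exact: cvg_id.
  - exact: cvg_cst.
by move=> pf; apply: polyfun_comp_continuous.
Qed.

Lemma edge_length_neq0 (R : realType) (T : 'I_3 -> R * R) (e : 'I_3) :
  nondegenerate_triangle T -> edge_length T e != 0.
Proof.
move=> nT; rewrite /edge_length /enorm gt_eqF// sqrtr_gt0 lt_def.
rewrite addr_ge0 ?sqr_ge0// andbT paddr_eq0 ?sqr_ge0// !sqrf_eq0.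
apply: contra_neqN nT => /andP[/eqP h1 /eqP h2].
move: e h1 h2; rewrite /edge_end /edge_start /det3 /cross /=.
by apply: ord3_ind; rewrite !ordS3E => /subr0_eq h1 /subr0_eq h2;
  rewrite ?h1 ?h2; ring.
Qed.

(** The length of the edge cancels against the normalization of the normal. *)
Lemma int_edge_flux (R : realType) (T : 'I_3 -> R * R) (e : 'I_3)
    (F1 F2 : R * R -> R) :
  nondegenerate_triangle T -> polyfun F1 -> polyfun F2 ->
  int_edge T e
    (fun p => F1 p * (outer_normal T e).1 + F2 p * (outer_normal T e).2) =
  Num.sg (det3 T) *
    ((edge_end T e - edge_start T e).2 * edge_mean T e F1 -
     (edge_end T e - edge_start T e).1 * edge_mean T e F2).
Proof.
move=> nT p1 p2; have L0 := edge_length_neq0 e nT.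
have i1 := continuous_itv01_integrable (continuous_edge (T := T) (e := e) p1).
have i2 := continuous_itv01_integrable (continuous_edge (T := T) (e := e) p2).
have m01 : measurable (`[0, 1]%classic : set R) by exact: measurable_itv.
have pc F (c : R) : polyfun F -> polyfun (fun q => F q * c).
  by move=> pF; apply: polyfunM => //; exact: polyfun_cst.
rewrite /int_edge RintegralD//; last 2 first.
- exact: (continuous_itv01_integrable (continuous_edge (pc _ _ p1))).
- exact: (continuous_itv01_integrable (continuous_edge (pc _ _ p2))).
rewrite !RintegralZr// -/(edge_mean T e F1) -/(edge_mean T e F2).
by rewrite /outer_normal /=; field.
Qed.

Lemma has_gradient_simplex (R : realType) (T : 'I_3 -> R * R)
    (f fx fy : R * R -> R) :
  has_gradient f fx fy ->
  has_gradient (f \o simplex T)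
    (fun q => fx (simplex T q) * (T 1 - T 0).1 +
              fy (simplex T q) * (T 1 - T 0).2)
    (fun q => fx (simplex T q) * (T 2%:R - T 0).1 +
              fy (simplex T q) * (T 2%:R - T 0).2).
Proof.
have [E1 E2] := simplex_affine T.
move=> hf c1 c2 d1 d2 s h1 h2.
have := hf _ _ _ _ _ (has_gradient_affine E1 h1 h2)
  (has_gradient_affine E2 h1 h2).
by move=> /is_derive_eq; apply; rewrite /=; ring.
Qed.

(** The sides of the reference triangle are mapped to the edges of [T], one of
    them with reversed orientation, which does not matter for the mean. *)
Lemma int2_ref_gradient (R : realType) (T : 'I_3 -> R * R)
    (f fu fv : R * R -> R) :
  polyfun f -> polyfun fu -> polyfun fv -> 
  has_gradient (f \o simplex T) fu fv ->
  int2 (ref_triangle R) fu = edge_mean T 0 f - edge_mean T 1 f /\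
  int2 (ref_triangle R) fv = edge_mean T 0 f - edge_mean T 2%:R f.
Proof.
move=> pf pfu pfv hf; have pfh := polyfun_simplex T pf.
have m01 : measurable (`[0, 1]%classic : set R) by exact: measurable_itv.
have ci (a b : R -> R) : continuous a -> continuous b ->
    (@lebesgue_measure R).-integrable `[0, 1]
      (EFin \o (fun s => f (simplex T (a s, b s)))).
  move=> ca cb; apply: continuous_itv01_integrable.
  exact: (polyfun_comp_continuous pfh).
have c1 : continuous (fun s : R => 1 - s).
  by move=> s; apply: cvgB; [exact: cvg_cst|exact: cvg_id].
have c0 : continuous (fun s : R => 0 : R) by move=> s; exact: cvg_cst.
have cid : continuous (fun s : R => s) by move=> s; exact: cvg_id.
have e0 s : simplex T (1 - s, s) = edge_point T 0 s.
  by rewrite /simplex /edge_point /edge_start /edge_end !ordS3E /=;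
    congr pair; ring.
have e1 s : simplex T (0, s) = edge_point T 1 (1 - s).
  by rewrite /simplex /edge_point /edge_start /edge_end !ordS3E /=;
    congr pair; ring.
have e2 s : simplex T (s, 0) = edge_point T 2%:R s.
  by rewrite /simplex /edge_point /edge_start /edge_end !ordS3E /=;
    congr pair; ring.
split.
  rewrite (int2_ref_triangle_dx pfh pfu hf) RintegralB//; try exact: ci.
  under eq_Rintegral do rewrite /= e0.
  under [X in _ - X]eq_Rintegral do rewrite /= e1.
  by rewrite (Rintegral01_flip (continuous_edge (T := T) (e := 1) pf)).
rewrite (int2_ref_triangle_dy pfh pfv hf) RintegralB//; try exact: ci.
congr (_ - _).
  apply: etrans (Rintegral01_flip (continuous_edge (T := T) (e := 0) pf)).
  by apply: eq_Rintegral => s _; rewrite -e0 /= subKr.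
by apply: eq_Rintegral => s _; rewrite -e2.
Qed.

(** By Cramer's rule, [det3 T] times the gradient of [f] is a combination of the
    two partial derivatives of [f \o simplex T], and the Jacobian of [simplex T]
    is [`|det3 T|]. *)
Lemma int2_triangle_gradient (R : realType) (T : 'I_3 -> R * R)
    (f fx fy : R * R -> R) :
  nondegenerate_triangle T ->
  polyfun f -> polyfun fx -> polyfun fy -> has_gradient f fx fy ->
  int2 (triangle T) fx = Num.sg (det3 T) *
    ((T 2%:R - T 0).2 * (edge_mean T 0 f - edge_mean T 1 f) -
     (T 1 - T 0).2 * (edge_mean T 0 f - edge_mean T 2%:R f)) /\
  int2 (triangle T) fy = Num.sg (det3 T) *
    ((T 1 - T 0).1 * (edge_mean T 0 f - edge_mean T 2%:R f) -
     (T 2%:R - T 0).1 * (edge_mean T 0 f - edge_mean T 1 f)).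
Proof.
move=> nT pf pfx pfy hf.
have hs := has_gradient_simplex T hf.
have psx := polyfun_simplex T pfx; have psy := polyfun_simplex T pfy.
have pc (c : R) h : polyfun h -> polyfun (fun q => h q * c).
  by move=> ph; apply: polyfunM => //; exact: polyfun_cst.
have pu := polyfunD (pc (T 1 - T 0).1 _ psx) (pc (T 1 - T 0).2 _ psy).
have pv := polyfunD (pc (T 2%:R - T 0).1 _ psx) (pc (T 2%:R - T 0).2 _ psy).
have [<- <-] := int2_ref_gradient pf pu pv hs.
have JE : `|det3 T| = Num.sg (det3 T) * det3 T by rewrite normrEsg.
have lin (c d : R) : int2 (ref_triangle R)
    (fun q => fx (simplex T q) * c + fy (simplex T q) * d) =
    int2 (ref_triangle R) (fx \o simplex T) * c +
    int2 (ref_triangle R) (fy \o simplex T) * d.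
  rewrite int2D_ref; [|exact: (pc c _ psx)|exact: (pc d _ psy)].
  by congr (_ + _); [exact: (int2Zr_ref c psx)|exact: (int2Zr_ref d psy)].
rewrite !int2_triangle// JE !lin; move: (Num.sg (det3 T)) => sg.
by rewrite /det3 /cross /=; split; ring.
Qed.

(** Expressed in the edge means, both sides are the same combination, since the
    edge vectors of a triangle add up to zero. *)
Lemma divergence_theorem (R : realType) (T : 'I_3 -> R * R)
    (F1 F1x F1y F2 F2x F2y : R * R -> R) :
  nondegenerate_triangle T ->
  polyfun F1 -> polyfun F1x -> polyfun F1y -> has_gradient F1 F1x F1y ->
  polyfun F2 -> polyfun F2x -> polyfun F2y -> has_gradient F2 F2x F2y ->
  \sum_e int_edge T e
    (fun p => F1 p * (outer_normal T e).1 + F2 p * (outer_normal T e).2) =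
  int2 (triangle T) F1x + int2 (triangle T) F2y.
Proof.
move=> nT p1 p1x p1y h1 p2 p2x p2y h2.
have [-> _] := int2_triangle_gradient nT p1 p1x p1y h1.
have [_ ->] := int2_triangle_gradient nT p2 p2x p2y h2.
under eq_bigr do rewrite int_edge_flux//.
rewrite big_ord3 /edge_end /edge_start !ordS3E /=; ring.
Qed.

(** * Vanishing of polynomials with zero mean square *)

(** The integrand is the derivative of the second coordinate, so the integral is
    that of the height [1 - x] of the slices. *)
Lemma int2_ref_triangle1 (R : realType) :
  int2 (ref_triangle R) (fun=> 1) = 2%:R^-1.
Proof.
have hy : has_gradient (fun p : R * R => p.2) (fun=> 0) (fun=> 1).
  by apply: (@has_gradient_affine _ _ 0) => p; rewrite mul0r mul1r !add0r.
rewrite (int2_ref_triangle_dy (polyfun_snd R) (polyfun_cst 1) hy) /=.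
pose F (x : R) := x - 2%:R^-1 * (x * x).
have dF (x : R) : is_derive x (1 : R) F (1 - x - 0).
  have := is_deriveB (is_derive_id x (1 : R))
    (is_deriveZ 2%:R^-1
      (is_deriveM (is_derive_id x (1 : R)) (is_derive_id x (1 : R)))).
  by move=> /is_derive_eq; apply; rewrite /GRing.scale /=; field.
rewrite /Rintegral (integral_FTC ler01 dF) /F /=; first by field.
move=> x; do 2 (apply: cvgB; last exact: cvg_cst || exact: cvg_id).
exact: cvg_cst.
Qed.

(** If [q p0] were nonzero, the square of [q] would be bounded below on a copy
    of the triangle shrunk towards [p0], which stays inside by convexity and has
    positive area. *)
Lemma polyfun_sqr_int_eq0 (R : realType) (q : R * R -> R) :
  polyfun q -> int2 (ref_triangle R) (fun p => q p * q p) = 0 ->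
  forall p, ref_triangle R p -> q p = 0.
Proof.
move=> pq I0 p0 [p01 p02 p012]; apply/eqP/negPn/negP => q0.
pose h p := q p * q p.
have ph : polyfun h by exact: polyfunM.
have h0 p : 0 <= h p by rewrite /h -expr2 sqr_ge0.
have hp0 : 0 < h p0 by rewrite lt_def h0 /h mulf_neq0.
pose m := h p0 / 2%:R.
have m_gt0 : 0 < m by rewrite divr_gt0.
have ch : continuous (fun p : R * R => h (p.1, p.2)).
  by apply: polyfun_comp_continuous => // p; [exact: cvg_fst|exact: cvg_snd].
have /nbhs_ballP[r /= r0 hr] : \forall p \near p0, m < h p.
  have := ch p0 => /cvgr_gt; rewrite -surjective_pairing => /(_ m).
  have -> : m < h p0 by rewrite /m ltr_pdivrMr// ltr_pMr// ltr1n.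
  move=> /(_ erefl); apply: filterS => p.
  by rewrite -surjective_pairing.
(* [e] is the ratio of the homothety of center [p0] *)
pose e := Num.min 1 (r / 2%:R).
have e0 : 0 < e by rewrite lt_min ltr01 divr_gt0.
have e1 : e <= 1 by rewrite ge_min lexx.
have er : e < r.
  by rewrite gt_min; apply/orP; right; rewrite ltr_pdivrMr// ltr_pMr// ltr1n.
pose T : 'I_3 -> R * R := fun a =>
  ((1 - e) * p0.1 + e * (a == 1)%:R, (1 - e) * p0.2 + e * (a == 2%:R)%:R).
have TE q' : simplex T q' =
    ((1 - e) * p0.1 + e * q'.1, (1 - e) * p0.2 + e * q'.2).
  by rewrite /simplex /T /=; congr pair; ring.
have detT : det3 T = e * e.
  by rewrite /det3 /cross /T /=; ring.
have nT : nondegenerate_triangle T.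
  by rewrite /nondegenerate_triangle detT mulf_neq0// gt_eqF.
have subT : triangle T `<=` ref_triangle R.
  move=> p; have [_ <-] := simplex_bary p nT.
  move: (bary T 1 p) (bary T 2%:R p) => x y.
  move=> /(triangle_simplex _ nT)[/= x0 y0 xy]; rewrite TE.
  have e1' : 0 <= 1 - e by rewrite subr_ge0.
  have e0' := ltW e0.
  split; [exact: addr_ge0 (mulr_ge0 e1' p01) (mulr_ge0 e0' x0)|
    exact: addr_ge0 (mulr_ge0 e1' p02) (mulr_ge0 e0' y0)|].
  have h1 : 0 <= 1 - (p0.1 + p0.2) by rewrite subr_ge0.
  have h2 : 0 <= 1 - (x + y) by rewrite subr_ge0.
  have := mulr_ge0 e1' h1; have := mulr_ge0 e0' h2; rewrite /=; lra.
have : m * 2%:R^-1 <= int2 (ref_triangle R) (h \o simplex T).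
  rewrite mulrC -int2_ref_triangle1 -(int2Zr_ref m (polyfun_cst 1)).
  apply: le_Rintegral.
  - exact: measurable_ref_triangle.
  - apply: (@integrable_ref_triangle _ (fun=> 1 * m)); exact: polyfun_cst.
  - exact: (integrable_ref_triangle (polyfun_simplex T ph)).
  move=> p [p1 p2 p12]; rewrite mul1r ltW//; apply: hr.
  rewrite /= TE; split; rewrite /ball /= ltr_norml; apply/andP; split; nra.
have : int2 (triangle T) h <= int2 (ref_triangle R) h.
  have iR := integrable_ref_triangle ph.
  have mT := measurable_triangle nT.
  have iT : (lebesgue_measure \x lebesgue_measure)%E.-integrable
      (triangle T : set (mplane R)) (EFin \o h).
    by apply: integrableS iR => //; exact: measurable_ref_triangle.
  apply: fine_le; [exact: integrable_fin_num|
    apply: integrable_fin_num => //; exact: measurable_ref_triangle|].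
  apply: ge0_subset_integral => //.
  - exact: measurable_ref_triangle.
  - by case/integrableP: iR.
  - by move=> p _; rewrite /= lee_fin.
rewrite I0 int2_triangle// detT => hle hge.
have : 0 < `|e * e| * int2 (ref_triangle R) (h \o simplex T).
  rewrite mulr_gt0// ?normr_gt0 ?mulf_neq0// ?gt_eqF//.
  by apply: lt_le_trans hge; rewrite mulr_gt0// invr_gt0.
by rewrite ltNge hle.
Qed.

(** * Integration on triangles *)

Lemma area_triangle (R : realType) (T : 'I_3 -> R * R) :
  nondegenerate_triangle T -> area (triangle T) = `|det3 T| / 2%:R.
Proof.
move=> nT; rewrite -int2_ref_triangle1.
rewrite -[RHS](@int2_triangle _ _ (fun=> 1) nT (polyfun_cst 1)).
by rewrite /int2 Rintegral_cst ?mul1r//; exact: measurable_triangle.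
Qed.

(** Both integrals are pulled back to the same one on the reference triangle. *)
Lemma int2_affmap (R : realType) (S T : 'I_3 -> R * R) (f : R * R -> R) :
  nondegenerate_triangle S -> nondegenerate_triangle T -> polyfun f ->
  int2 (triangle T) (f \o affmap T S) =
  area (triangle T) / area (triangle S) * int2 (triangle S) f.
Proof.
move=> nS nT pf; rewrite !area_triangle//.
have pfa := polyfun_affmap T S pf.
rewrite !int2_triangle// (_ : _ \o _ \o simplex T = f \o simplex S).
  have dS : `|det3 S| != 0 by rewrite normr_eq0.
  by field.
by apply/funext => q /=; rewrite affmap_simplex.
Qed.

Lemma int2Zl_triangle (R : realType) (T : 'I_3 -> R * R) (a : R)
    (f : R * R -> R) :
  nondegenerate_triangle T -> polyfun f ->
  int2 (triangle T) (fun p => a * f p) = a * int2 (triangle T) f.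
Proof.
move=> nT pf; have iR := integrable_ref_triangle (polyfun_simplex T pf).
rewrite int2_triangle//; last by apply: polyfunM => //; exact: polyfun_cst.
rewrite int2_triangle// mulrCA; congr (_ * _).
by apply: RintegralZl => //; exact: measurable_ref_triangle.
Qed.

Lemma int2D_triangle (R : realType) (T : 'I_3 -> R * R) (f h : R * R -> R) :
  nondegenerate_triangle T -> polyfun f -> polyfun h ->
  int2 (triangle T) (fun p => f p + h p) =
  int2 (triangle T) f + int2 (triangle T) h.
Proof.
move=> nT pf ph; rewrite !int2_triangle//; last exact: polyfunD.
rewrite -mulrDr; congr (_ * _).
exact: (int2D_ref (polyfun_simplex T pf) (polyfun_simplex T ph)).
Qed.

Lemma eq_int2 (R : realType) (D : set (R * R)) (f h : R * R -> R) :
  (forall p, D p -> f p = h p) -> int2 D f = int2 D h.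
Proof. by move=> fh; apply: eq_Rintegral => p; rewrite inE; exact: fh. Qed.

Lemma eq_int_edge (R : realType) (T : 'I_3 -> R * R) (e : 'I_3)
    (f h : R * R -> R) :
  (forall r, 0 <= r <= 1 -> f (edge_point T e r) = h (edge_point T e r)) ->
  int_edge T e f = int_edge T e h.
Proof.
move=> fh; congr (_ * _); apply: eq_Rintegral => r.
by rewrite inE /= in_itv; exact: fh.
Qed.

(** The divergence theorem for the vector field phi (G1, G2). *)
Lemma weak_divergence (R : realType) (T : 'I_3 -> R * R)
    (phi G1 G1x G1y G2 G2x G2y : R * R -> R) :
  nondegenerate_triangle T -> polyfun phi ->
  polyfun G1 -> polyfun G1x -> polyfun G1y -> has_gradient G1 G1x G1y ->
  polyfun G2 -> polyfun G2x -> polyfun G2y -> has_gradient G2 G2x G2y ->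
  \sum_e int_edge T e (fun p => phi p *
      (G1 p * (outer_normal T e).1 + G2 p * (outer_normal T e).2)) =
  int2 (triangle T) (fun p => G1 p * dx phi p + G2 p * dy phi p) +
  int2 (triangle T) (fun p => (G1x p + G2y p) * phi p).
Proof.
move=> nT pp p1 p1x p1y h1 p2 p2x p2y h2.
have [px [py [ppx ppy hp]]] := polyfun_gradient pp.
rewrite (has_gradient_dx hp) (has_gradient_dy hp).
have PM := polyfunM; have PD := polyfunD.
have dv := divergence_theorem nT (polyfunM pp p1)
  (PD _ _ _ (PM _ _ _ ppx p1) (PM _ _ _ pp p1x))
  (PD _ _ _ (PM _ _ _ ppy p1) (PM _ _ _ pp p1y)) (has_gradientM hp h1)
  (polyfunM pp p2)
  (PD _ _ _ (PM _ _ _ ppx p2) (PM _ _ _ pp p2x))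
  (PD _ _ _ (PM _ _ _ ppy p2) (PM _ _ _ pp p2y)) (has_gradientM hp h2).
transitivity (\sum_e int_edge T e (fun p =>
    phi p * G1 p * (outer_normal T e).1 + phi p * G2 p * (outer_normal T e).2)).
  by apply: eq_bigr => e _; apply: eq_int_edge => r _; rewrite mulrDr !mulrA.
rewrite dv -!int2D_triangle//; try by do ?[apply: PD|apply: PM].
by apply: eq_int2 => p _; ring.
Qed.

(** * Fluxes at a lake at rest *)

Lemma vec3E (R : realType) (a b c : R) :
  [/\ vec3 a b c 0 0 = a, vec3 a b c 1 0 = b & vec3 a b c 2%:R 0 = c].
Proof. by rewrite /vec3 !mxE. Qed.

Lemma vec3P (R : realType) (U : 'cV[R]_3) (a b c : R) :
  U 0 0 = a -> U 1 0 = b -> U 2%:R 0 = c -> U = vec3 a b c.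
Proof.
have [a0 b0 c0] := vec3E a b c.
by move=> h0 h1 h2; apply/colP; apply: ord3_ind; rewrite ?a0 ?b0 ?c0.
Qed.

Lemma vec3D (R : realType) (a b c a' b' c' : R) :
  vec3 a b c + vec3 a' b' c' = vec3 (a + a') (b + b') (c + c').
Proof. by apply: vec3P; rewrite !mxE. Qed.

Lemma vec3B (R : realType) (a b c a' b' c' : R) :
  vec3 a b c - vec3 a' b' c' = vec3 (a - a') (b - b') (c - c').
Proof. by apply: vec3P; rewrite !mxE. Qed.

Lemma vec3Z (R : realType) (t a b c : R) :
  t *: vec3 a b c = vec3 (t * a) (t * b) (t * c).
Proof. by apply: vec3P; rewrite !mxE. Qed.

Lemma mulmx_col2 (R : realType) (M : 'M[R]_(3, 2)) (n : R * R) (i : 'I_3) :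
  (M *m col2 n) i 0 = M i 0 * n.1 + M i 1 * n.2.
Proof.
rewrite mxE !big_ord_recl big_ord0 addr0 /col2 !mxE /=.
by rewrite (_ : lift ord0 ord0 = 1 :> 'I_2)//; apply: val_inj.
Qed.

Lemma mat32E (R : realType) (r0 r1 r2 n : R * R) :
  mat32 [:: r0; r1; r2] *m col2 n =
  vec3 (r0.1 * n.1 + r0.2 * n.2) (r1.1 * n.1 + r1.2 * n.2)
    (r2.1 * n.1 + r2.2 * n.2).
Proof. by apply: vec3P; rewrite mulmx_col2 /mat32 /col2 !mxE. Qed.

Lemma col2_dot (R : realType) (U : 'cV[R]_3) (X n : R * R) :
  U *m (col2 X)^T *m col2 n = (X.1 * n.1 + X.2 * n.2) *: U.
Proof.
apply/colP => i; rewrite mulmx_col2 !mxE !big_ord1 !mxE /=; ring.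
Qed.

(** The pressure term of the flux when [eta = C]. *)
Definition still_pressure (R : realType) (g C h : R) : R :=
  2%:R^-1 * g * (2%:R * h * C - C ^+ 2).

Lemma fluxH_lake (R : realType) (g C h : R) (X n : R * R) :
  fluxH g (vec3 C 0 0) h X *m col2 n =
  vec3 (- C * (X.1 * n.1 + X.2 * n.2)) (still_pressure g C h * n.1)
    (still_pressure g C h * n.2).
Proof.
rewrite /fluxH mulmxBl col2_dot /fluxF mat32E.
have [E0 E1 E2] := vec3E C 0 0.
rewrite /eta_of /m_of /w_of E0 E1 E2.
rewrite vec3Z vec3B /= /still_pressure.
by congr vec3; rewrite ?expr2 ?mul0r; ring.
Qed.

Lemma recon_lake (R : realType) (C h hs : R) :
  recon (vec3 C 0 0) h hs = vec3 C 0 0.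
Proof.
have [E0 E1 E2] := vec3E C 0 0.
by rewrite /recon /eta_of /m_of /w_of E0 E1 E2 !mulr0.
Qed.

(** Equal surface elevations give equal reconstructed depths on both sides, so
    the two physical fluxes agree, the dissipation vanishes, and the correction
    replaces the reconstructed depth by the actual one. *)
Lemma modified_flux_lake (R : realType) (g : R) (Nv Ne : nat)
    (conn : 'I_Ne -> 'I_3 -> 'I_Nv) (x xd : 'I_Nv -> R * R) (s : stage R Ne)
    (K : 'I_Ne) (e : 'I_3) (p : R * R) (C : R) :
  sol s K p = vec3 C 0 0 -> Uext conn s K e p = vec3 C 0 0 ->
  let X := mesh_vel conn x xd K p in
  let n := outer_normal (elt conn x K) e in
  let P := still_pressure g C (C - bot s K p) in
  modified_flux g conn x xd s K e p =
  vec3 (- C * (X.1 * n.1 + X.2 * n.2)) (P * n.1) (P * n.2).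
Proof.
move=> sE uE X n P; rewrite /modified_flux sE uE !recon_lake.
have [E0 E1 E2] := vec3E C 0 0.
have hE : hstar_ext conn s K e p = hstar_int conn s K e p.
  by rewrite /hstar_ext /hstar_int sE uE.
rewrite hE /lax_friedrichs subrr scaler0 subr0 mulmxDl -/X -/n.
rewrite !fluxH_lake /flux_correction mat32E sE /depth sE /eta_of E0.
rewrite vec3D vec3Z vec3D /P /still_pressure.
by clearbody X n; congr vec3; rewrite /=; field.
Qed.

Lemma segment_in_triangle (R : realType) (T : 'I_3 -> R * R) (a b : 'I_3)
    (r : R) :
  0 <= r <= 1 ->
  triangle T ((1 - r) * (T a).1 + r * (T b).1, (1 - r) * (T a).2 + r * (T b).2).
Proof.
move=> /andP[r0 r1]; have r1' : 0 <= 1 - r by rewrite subr_ge0.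
have sumd (F : 'I_3 -> R) j : \sum_i (i == j)%:R * F i = F j.
  rewrite (bigD1 j)//= eqxx mul1r big1 ?addr0// => i /negbTE ->.
  by rewrite mul0r.
have sumE (F : 'I_3 -> R) :
    \sum_i ((1 - r) * (i == a)%:R + r * (i == b)%:R) * F i =
    (1 - r) * F a + r * F b.
  under eq_bigr do rewrite mulrDl -!mulrA.
  by rewrite big_split -!big_distrr !sumd.
exists (fun i => (1 - r) * (i == a)%:R + r * (i == b)%:R).
split => [i|i||/=|/=].
- by rewrite addr_ge0// mulr_ge0.
- by rewrite inE.
- have := sumE (fun=> 1); rewrite !mulr1 subrK; apply: etrans.
  by apply: eq_bigr => i _; rewrite mulr1.
- by rewrite (sumE (fun i => (T i).1)).
- by rewrite (sumE (fun i => (T i).2)).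
Qed.

Lemma lake_sol (R : realType) (Nv Ne : nat) (conn : 'I_Ne -> 'I_3 -> 'I_Nv)
    (x : 'I_Nv -> R * R) (s : stage R Ne) (C : R) (K : 'I_Ne) (p : R * R) :
  lake_at_rest conn x s C -> triangle (elt conn x K) p ->
  sol s K p = vec3 C 0 0.
Proof. by move=> lk /lk[h0 h1 h2]; exact: vec3P. Qed.

(** Across an interior edge, both end points are vertices of the neighbouring
    triangle, which contains the edge by convexity; on the boundary this is the
    compatibility of the boundary data. *)
Lemma lake_Uext (R : realType) (k Nv Ne : nat) (conn : 'I_Ne -> 'I_3 -> 'I_Nv)
    (x : 'I_Nv -> R * R) (s : stage R Ne) (C : R) (K : 'I_Ne) (e : 'I_3)
    (r : R) :
  admissible conn k x s -> lake_at_rest conn x s C -> 0 <= r <= 1 ->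
  Uext conn s K e (edge_point (elt conn x K) e r) = vec3 C 0 0.
Proof.
move=> [_ _ _ _ bdC] lk r01; have bd := bdC C lk.
rewrite /Uext; case nb: (neighbor conn K e) => [K'|]; last first.
  by apply: bd => //; exists r.
move: nb; rewrite /neighbor; case: pickP => // K2.
move=> /andP[_ /fintype.subsetP sub] [<-].
have /imsetP[a _ aE] : conn K (ordS e) \in verts conn K2.
  by apply: sub; rewrite !inE eqxx.
have /imsetP[b _ bE] : conn K (ordS (ordS e)) \in verts conn K2.
  by apply: sub; rewrite !inE eqxx orbT.
apply: (lake_sol lk).
rewrite /edge_point /edge_start /edge_end /elt aE bE.
exact: (segment_in_triangle (elt conn x K2) a b r01).
Qed.

(** * Moments of a lake at rest *)

Lemma moment_lake (R : realType) (Nv Ne : nat)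
    (conn : 'I_Ne -> 'I_3 -> 'I_Nv) (x : 'I_Nv -> R * R) (s : stage R Ne)
    (Khat : 'I_3 -> R * R) (C : R) (K : 'I_Ne) (phihat : R * R -> R) :
  nondegenerate_triangle (elt conn x K) -> nondegenerate_triangle Khat ->
  lake_at_rest conn x s C -> polyfun phihat ->
  moment conn Khat x s (test_fun conn Khat x phihat K) K =
  (vol s K / area (triangle Khat) * int2 (triangle Khat) phihat) *: vec3 C 0 0.
Proof.
move=> nT nKhat lk pp; apply/colP => i; rewrite /moment mxE [RHS]mxE.
rewrite [X in _ * X = _](_ : _ = vec3 C 0 0 i 0 * int2 (triangle Khat) phihat).
  by ring.
rewrite -int2Zl_triangle//; apply: eq_int2 => p Kp /=.
rewrite /test_fun /= affmapK// (lake_sol lk)//.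
have [q pE] := simplex_surj p nKhat; move: Kp; rewrite pE affmap_simplex//.
by move=> /(triangle_simplex _ nKhat) /(triangle_simplex _ nT).
Qed.

(** * One stage of the scheme *)

Lemma affine_sum (R : realType) (I : Type) (r : seq I) (P : pred I)
    (F : I -> R * R -> R) :
  (forall i, affine (F i)) -> affine (fun p => \sum_(i <- r | P i) F i p).
Proof.
move=> aF; elim: r => [|i r [a [b [c IH]]]].
  by exists 0, 0, 0 => p; rewrite big_nil !mul0r !addr0.
have [a' [b' [c' E]]] := aF i.
case Pi : (P i).
  exists (a' + a), (b' + b), (c' + c) => p.
  by rewrite big_cons Pi E IH; ring.
by exists a, b, c => p; rewrite big_cons Pi IH.
Qed.

Lemma affine_mesh_vel (R : realType) (Nv Ne : nat)
    (conn : 'I_Ne -> 'I_3 -> 'I_Nv) (x xd : 'I_Nv -> R * R) (K : 'I_Ne) :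
  affine (fun p => (mesh_vel conn x xd K p).1) /\
  affine (fun p => (mesh_vel conn x xd K p).2).
Proof.
have aZ (t : R) f : affine f -> affine (fun p => t * f p).
  move=> [a [b [c E]]]; exists (t * a), (t * b), (t * c) => p.
  by rewrite E; ring.
have an i : affine (nodal conn x i K).
  by apply: affine_sum => a; exact: affine_bary.
by split; rewrite /mesh_vel /=; apply: affine_sum => i; apply: aZ.
Qed.

(** With [q] the deviation of one component from its constant value [c], testing
    with [q] gives equal integrals of [(q + c) q] and of [c q], so that the
    integral of [q ^ 2] is zero. *)
Lemma lake_of_moment (R : realType) (k : nat) (Nv Ne : nat)
    (conn : 'I_Ne -> 'I_3 -> 'I_Nv) (x : 'I_Nv -> R * R) (s : stage R Ne)
    (Khat : 'I_3 -> R * R) (C : R) :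
  admissible conn k x s ->
  (forall K, nondegenerate_triangle (elt conn x K)) ->
  nondegenerate_triangle Khat ->
  (forall K phihat, poly_deg k phihat ->
    moment conn Khat x s (test_fun conn Khat x phihat K) K =
    (vol s K / area (triangle Khat) * int2 (triangle Khat) phihat) *:
      vec3 C 0 0) ->
  lake_at_rest conn x s C.
Proof.
move=> [degU _ vol_gt0 _ _] nT nKhat mom K p Kp.
suff solE i : sol s K p i 0 = vec3 C 0 0 i 0.
  have [E0 E1 E2] := vec3E C 0 0.
  by rewrite /eta_of /m_of /w_of !solE E0 E1 E2.
set c := vec3 C 0 0 i 0.
pose T := elt conn x K.
pose q p := sol s K (affmap Khat T p) i 0 - c.
have [aff1 aff2] := affine_affmap Khat T.
have dq : poly_deg k q.
  apply: poly_degD (poly_deg_cst k (- c)).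
  exact: (poly_deg_comp_affine aff1 aff2 (degU K i)).
have pq := polyfun_poly_deg dq.
have pqq := polyfunM pq pq.
have area0 : area (triangle Khat) != 0.
  by rewrite area_triangle// mulf_neq0// ?normr_eq0// invr_eq0.
have vol0 : vol s K != 0 by rewrite gt_eqF.
have := congr1 (fun U : 'cV[R]_3 => U i 0) (mom K q dq).
rewrite /moment mxE [X in _ = X]mxE -/c.
rewrite -[RHS]mulrA => /mulfI; rewrite mulf_neq0 ?invr_eq0// => /(_ isT).
rewrite (eq_int2 (h := fun p => q p * q p + c * q p)); last first.
  move=> r Kr /=; rewrite /test_fun /= affmapK//.
  by rewrite /q; ring.
rewrite int2D_triangle//; last by apply: polyfunM => //; exact: polyfun_cst.
rewrite int2Zl_triangle// [c * _]mulrC => /(canRL (addrK _)); rewrite subrr.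
rewrite int2_triangle// => /eqP; rewrite mulf_eq0 normr_eq0 (negbTE nKhat) /=.
move=> /eqP /(polyfun_sqr_int_eq0 (polyfun_simplex Khat pq)) q0.
have [r pE] := simplex_surj p (nT K).
have /q0 : ref_triangle R r by apply/(triangle_simplex _ (nT K)); rewrite -pE.
by rewrite /q /= affmap_simplex// -pE => /subr0_eq.
Qed.

(** [(G1, G2)] is the [i]-th row of the flux at the lake at rest, the same on
    the edges and inside, and [S] is the source: integration by parts leaves
    [S - div G] tested with [phi]. *)
Lemma residual_component (R : realType) (g : R) (k : nat) (Nv Ne : nat)
    (conn : 'I_Ne -> 'I_3 -> 'I_Nv) (x xd : 'I_Nv -> R * R) (s : stage R Ne)
    (C : R) (K : 'I_Ne) (i : 'I_3)
    (phi G1 G1x G1y G2 G2x G2y S : R * R -> R) :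
  admissible conn k x s -> nondegenerate_triangle (elt conn x K) ->
  lake_at_rest conn x s C -> polyfun phi ->
  polyfun G1 -> polyfun G1x -> polyfun G1y -> has_gradient G1 G1x G1y ->
  polyfun G2 -> polyfun G2x -> polyfun G2y -> has_gradient G2 G2x G2y ->
  (forall p n, let X := mesh_vel conn x xd K p in
    let P := still_pressure g C (C - bot s K p) in
    vec3 (- C * (X.1 * n.1 + X.2 * n.2)) (P * n.1) (P * n.2) i 0 =
    G1 p * n.1 + G2 p * n.2) ->
  (forall p, triangle (elt conn x K) p ->
    source g (fun q => eta_of (sol s K q)) (bot s K) p i 0 = S p) ->
  residual g conn x xd s phi K i 0 =
  int2 (triangle (elt conn x K)) (fun p => S p * phi p) -
  int2 (triangle (elt conn x K)) (fun p => (G1x p + G2y p) * phi p).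
Proof.
move=> ad nT lk pphi p1 p1x p1y g1 p2 p2x p2y g2 GE SE.
rewrite /residual mxE.
rewrite (eq_bigr (fun e => int_edge (elt conn x K) e (fun p => phi p *
  (G1 p * (outer_normal (elt conn x K) e).1 +
   G2 p * (outer_normal (elt conn x K) e).2)))); last first.
  move=> e _; apply: eq_int_edge => r r01; rewrite -GE.
  have inT := segment_in_triangle (elt conn x K) (ordS e) (ordS (ordS e)) r01.
  by rewrite (modified_flux_lake g x xd (lake_sol lk inT)
    (lake_Uext K e ad lk r01)).
rewrite (weak_divergence nT pphi p1 p1x p1y g1 p2 p2x p2y g2).
rewrite [X in _ + X + _](eq_int2
  (h := fun p => G1 p * dx phi p + G2 p * dy phi p)); last first.
  move=> p Tp; rewrite /depth (lake_sol lk Tp).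
  have [E0 _ _] := vec3E C 0 0; rewrite /eta_of E0 fluxH_lake.
  exact: (GE p (dx phi p, dy phi p)).
rewrite [X in _ + X = _](eq_int2 (h := fun p => S p * phi p)); first by ring.
by move=> p Tp; rewrite SE.
Qed.

(** For eta, G is - C times the mesh velocity and there is no source; for m and
    w, div G = S.  The factor [vol s K] cancels the one in [div_vel], and the
    actual area of the element enters both sides in the same way, through the
    flux of the velocity and through the integral of the test function. *)
Lemma residual_lake (R : realType) (g : R) (k : nat) (Nv Ne : nat)
    (conn : 'I_Ne -> 'I_3 -> 'I_Nv) (x xd : 'I_Nv -> R * R) (s : stage R Ne)
    (Khat : 'I_3 -> R * R) (C : R) (K : 'I_Ne) (phihat : R * R -> R) :
  admissible conn k x s -> nondegenerate_triangle (elt conn x K) ->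
  nondegenerate_triangle Khat ->
  lake_at_rest conn x s C -> polyfun phihat ->
  residual g conn x xd s (test_fun conn Khat x phihat K) K =
  (vol s K * div_vel conn x xd s K / area (triangle Khat) *
   int2 (triangle Khat) phihat) *: vec3 C 0 0.
Proof.
move=> ad nT nKhat lk pp; have [_ degB vol_gt0 _ _] := ad.
set phi := test_fun _ _ _ _ _.
have pphi : polyfun phi by exact: (polyfun_affmap (elt conn x K) Khat pp).
have [aX1 aX2] := affine_mesh_vel conn x xd K.
have pX1 := polyfun_affine aX1; have pX2 := polyfun_affine aX2.
have [a1 [b1 [c1 /has_gradient_affine gX1]]] := aX1.
have [a2 [b2 [c2 /has_gradient_affine gX2]]] := aX2.
have pB := polyfun_poly_deg (degB K).
have [Bx [By [pBx pBy gB]]] := polyfun_gradient pB.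
have pcst := @polyfun_cst R.
have gcst c : has_gradient (fun=> c : R) (fun=> 0) (fun=> 0).
  by apply: (@has_gradient_affine _ _ c) => p; rewrite !mul0r !addr0.
have pM (c d : R) f h : polyfun f -> polyfun h ->
    polyfun (fun p => c * f p + d * h p).
  by move=> pf ph; apply: polyfunD; exact: polyfunM.
have eta0 p : triangle (elt conn x K) p -> eta_of (sol s K p) = C.
  by move=> /lk[].
(* g h C - g C^2 / 2 with h = C - B *)
have PE p : still_pressure g C (C - bot s K p) =
    2%:R^-1 * g * C ^+ 2 + - (g * C) * bot s K p.
  by rewrite /still_pressure; field.
have pP : polyfun (fun p => 2%:R^-1 * g * C ^+ 2 + - (g * C) * bot s K p).
  by apply: polyfunD => //; exact: polyfunM.
have gP := has_gradientD (gcst (2%:R^-1 * g * C ^+ 2))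
  (has_gradientM (gcst (- (g * C))) gB).
have pgP h : polyfun h ->
    polyfun (fun p => 0 + (0 * bot s K p + - (g * C) * h p)).
  by move=> ph; apply: polyfunD => //; exact: pM.
rewrite vec3Z; apply: vec3P; rewrite ?mulr0.
- rewrite (residual_component (S := fun=> 0) ad nT lk pphi
    (polyfunM (pcst (- C)) pX1) (pM _ _ _ _ pX1 (pcst b1))
    (pM _ _ _ _ pX1 (pcst c1)) (has_gradientM (gcst (- C)) gX1)
    (polyfunM (pcst (- C)) pX2) (pM _ _ _ _ pX2 (pcst b2))
    (pM _ _ _ _ pX2 (pcst c2)) (has_gradientM (gcst (- C)) gX2)).
  + rewrite [X in _ - X](eq_int2 (h := fun p => - (C * (b1 + c2)) * phi p));
      last by move=> p _; ring.
    rewrite !int2Zl_triangle//.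
    rewrite (_ : phi = phihat \o affmap (elt conn x K) Khat)// int2_affmap//.
    (* div_vel is the quotient by vol of the boundary flux of the velocity *)
    have -> : vol s K * div_vel conn x xd s K =
        (b1 + c2) * area (triangle (elt conn x K)).
      rewrite /div_vel mulrCA divff ?gt_eqF// mulr1.
      rewrite (divergence_theorem nT pX1 _ _ gX1 pX2 _ _ gX2)//.
      have mT := measurable_triangle nT.
      by rewrite /int2 (Rintegral_cst _ mT b1) (Rintegral_cst _ mT c2) -mulrDl.
    have ? : area (triangle Khat) != 0.
      by rewrite area_triangle// mulf_neq0// ?normr_eq0// invr_eq0.
    by field.
  + by move=> p n /=; rewrite /vec3 mxE /=; ring.
  + by move=> p _; rewrite /source /vec3 mxE.
- rewrite (residual_component (S := fun p => - (g * C) * Bx p) ad nT lk pphi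
    pP (pgP _ pBx) (pgP _ pBy) gP (pcst 0) (pcst 0) (pcst 0) (gcst 0)).
  + by apply/eqP; rewrite subr_eq0; apply/eqP; apply: eq_int2 => p _; ring.
  + by move=> p n /=; rewrite -PE /vec3 mxE /= mul0r addr0.
  + move=> p Tp; rewrite /source (has_gradient_dx gB) eta0// /vec3 mxE /=.
    by ring.
- rewrite (residual_component (S := fun p => - (g * C) * By p) ad nT lk pphi
    (pcst 0) (pcst 0) (pcst 0) (gcst 0) pP (pgP _ pBx) (pgP _ pBy) gP).
  + by apply/eqP; rewrite subr_eq0; apply/eqP; apply: eq_int2 => p _; ring.
  + by move=> p n /=; rewrite -PE /vec3 mxE /= mul0r add0r.
  + move=> p Tp; rewrite /source (has_gradient_dy gB) eta0// /vec3 mxE /=.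
    by ring.
Qed.

Theorem proposition2p6 (R : realType) (g : R) (k : nat)
    (Omega : set (R * R)) (Nv Ne : nat) (conn : 'I_Ne -> 'I_3 -> 'I_Nv)
    (tn tn1 : R) (xn xn1 : 'I_Nv -> R * R) (Khat : 'I_3 -> R * R)
    (s0 s1 s2 s3 : stage R Ne) :
  let dt := tn1 - tn in
  let xat := vertex_at tn tn1 xn xn1 in
  let x0 := xat tn in
  let x1 := xat (tn + dt) in
  let x2 := xat (tn + 2%:R^-1 * dt) in
  let x3 := xat (tn + dt) in
  let xd := nodal_vel tn tn1 xn xn1 in
  0 < g -> (1 <= k)%N -> tn < tn1 ->
  polygonal_domain Omega ->
  (forall t, tn <= t <= tn1 -> triangulation conn Omega (xat t)) ->
  nondegenerate_triangle Khat ->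
  admissible conn k x0 s0 -> admissible conn k x1 s1 ->
  admissible conn k x2 s2 -> admissible conn k x3 s3 ->
  (forall K, vol s0 K = area (triangle (elt conn x0 K))) ->
  (forall K, vol s1 K =
     vol s0 K + dt * vol s0 K * div_vel conn x0 xd s0 K) ->
  (forall K, vol s2 K =
     3%:R / 4%:R * vol s0 K
     + 4%:R^-1 * (vol s1 K + dt * vol s1 K * div_vel conn x1 xd s1 K)) ->
  (forall K, vol s3 K =
     3%:R^-1 * vol s0 K
     + 2%:R / 3%:R * (vol s2 K + dt * vol s2 K * div_vel conn x2 xd s2 K)) ->
  (forall K phihat, poly_deg k phihat ->
     moment conn Khat x1 s1 (test_fun conn Khat x1 phihat K) K =
     moment conn Khat x0 s0 (test_fun conn Khat x0 phihat K) K
     + dt *: residual g conn x0 xd s0 (test_fun conn Khat x0 phihat K) K) ->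
  (forall K phihat, poly_deg k phihat ->
     moment conn Khat x2 s2 (test_fun conn Khat x2 phihat K) K =
     (3%:R / 4%:R) *: moment conn Khat x0 s0 (test_fun conn Khat x0 phihat K) K
     + 4%:R^-1 *: moment conn Khat x1 s1 (test_fun conn Khat x1 phihat K) K
     + (4%:R^-1 * dt) *:
         residual g conn x1 xd s1 (test_fun conn Khat x1 phihat K) K) ->
  (forall K phihat, poly_deg k phihat ->
     moment conn Khat x3 s3 (test_fun conn Khat x3 phihat K) K =
     3%:R^-1 *: moment conn Khat x0 s0 (test_fun conn Khat x0 phihat K) K
     + (2%:R / 3%:R) *: moment conn Khat x2 s2 (test_fun conn Khat x2 phihat K) K
     + (2%:R / 3%:R * dt) *:
         residual g conn x2 xd s2 (test_fun conn Khat x2 phihat K) K) ->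
  forall C : R, lake_at_rest conn x0 s0 C -> lake_at_rest conn x3 s3 C.
Proof.
move=> dt xat x0 x1 x2 x3 xd _ _ tn_lt _ tri nKhat ad0 ad1 ad2 ad3 _ v1 v2 v3
  m1 m2 m3 C lake0.
have nT t : tn <= t <= tn1 ->
    forall K, nondegenerate_triangle (elt conn (xat t) K).
  by move=> /tri[].
have nT0 : forall K, nondegenerate_triangle (elt conn x0 K).
  by apply: nT; rewrite lexx ltW.
have nT1 : forall K, nondegenerate_triangle (elt conn x1 K).
  by apply: nT; apply/andP; split; rewrite /dt; lra.
have nT2 : forall K, nondegenerate_triangle (elt conn x2 K).
  by apply: nT; apply/andP; split; rewrite /dt; lra.
have lake1 : lake_at_rest conn x1 s1 C.
  apply: (lake_of_moment ad1 nT1 nKhat) => K phihat dphi.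
  have pphi := polyfun_poly_deg dphi.
  rewrite m1// (moment_lake (nT0 K) nKhat lake0)//.
  rewrite (residual_lake g xd ad0 (nT0 K) nKhat lake0)// v1.
  by rewrite scalerA -scalerDl; congr (_ *: _); ring.
have lake2 : lake_at_rest conn x2 s2 C.
  apply: (lake_of_moment ad2 nT2 nKhat) => K phihat dphi.
  have pphi := polyfun_poly_deg dphi.
  rewrite m2// (moment_lake (nT0 K) nKhat lake0)//.
  rewrite (moment_lake (nT1 K) nKhat lake1)//.
  rewrite (residual_lake g xd ad1 (nT1 K) nKhat lake1)// v2.
  by rewrite !scalerA -!scalerDl; congr (_ *: _); ring.
apply: (lake_of_moment ad3 nT1 nKhat) => K phihat dphi.
have pphi := polyfun_poly_deg dphi.
rewrite m3// (moment_lake (nT0 K) nKhat lake0)//.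
rewrite (moment_lake (nT2 K) nKhat lake2)//.
rewrite (residual_lake g xd ad2 (nT2 K) nKhat lake2)// v3.
by rewrite !scalerA -!scalerDl; congr (_ *: _); ring.
Qed.
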